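(* For all but finitely many pairs of integers $(n,m)$ with $n>3$ and $m>3$ even, the simple random walk on $\Gamma_{n,m}$, with $\Gamma_{n,m}$ endowed with the geometric distance $d=d_{\mathbb{H}^2}$, satisfies \[ h_{\mu} < l_{d,\mu}\, v_d . \]
   Context: For integers $n\ge 3$ and $m$, let $\Delta_{n,m}\subset\mathbb{H}^2$ be a regular hyperbolic polygon with $n$ sides and all interior angles equal to $\frac{2\pi}{m}$ (whenever such a hyperbolic polygon exists). For even $m\ge 4$, the hyperbolic Coxeter group $\Gamma_{n,m}$ is the group generated by the reflections $r_1,\dots,r_n$ in the sides of $\Delta_{n,m}$ (sides labelled cyclically); it has presentation $\langle r_1,\dots,r_n \mid r_i^2=(r_ir_{i+1})^{m/2}=e\rangle$ (indices mod $n$) and acts geometrically on $\mathbb{H}^2$. The geometric distance: fix $x_0\in\mathbb{H}^2$ with trivial stabilizer and set $d_{\mathbb{H}^2}(g,h):=d_{\mathbb{H}^2}(g.x_0,h.x_0)$. The simple random walk is $X_k=\xi_1\cdots\xi_k$, $X_0=e$, where the $\xi_i$ are i.i.d. uniformly distributed on $\{r_1,\dots,r_n\}$; $\mu$ is its step distribution and $\mu_k$ the law of $X_k$. Invariants: logarithmic volume $v_d=\lim_{k\to\infty}\frac{\log|B_k|}{k}$ with $B_k=\{g: d(e,g)\le k\}$; Avez entropy $h_\mu=\lim_{k\to\infty}\frac{-\mathbb{E}[\log\mu_k(X_k)]}{k}$; drift $l_{d,\mu}=\lim_{k\to\infty}\frac{\mathbb{E}[d(e,X_k)]}{k}$. 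*)

(* Defs.v *)
From HB Require Import structures.
From mathcomp Require Import all_boot all_order all_algebra.
From mathcomp Require Import all_classical all_reals all_analysis.
From mathcomp Require Import finmap.

Unset Printing Implicit Defensive.
Import Order.TTheory GRing.Theory Num.Theory.
Local Open Scope ring_scope.

Section HypCoxeter.
Variable R : realType.

(* Hyperboloid model of H^2 in R^3 (column vectors), Minkowski form
   B(x,y) = x0 y0 - x1 y1 - x2 y2. *)
Definition J3 : 'M[R]_3 :=
  \matrix_(i < 3, j < 3) (if i == j then (if (i : nat) == 0%N then 1 else -1) else 0).

Definition mink (x y : 'cV[R]_3) : R := (x^T *m J3 *m y) 0 0.

Definition inH2 (x : 'cV[R]_3) : Prop := mink x x = 1 /\ 0 < x 0 0.

(* hyperbolic distance: cosh d(x,y) = B(x,y), d = arcosh B(x,y) *)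
Definition hdist (x y : 'cV[R]_3) : R :=
  let c := mink x y in ln (c + Num.sqrt (c ^+ 2 - 1)).

(* Unit spacelike normal of side i of the regular n-gon Delta_{n,m} centred at
   (1,0,0) with all interior angles 2 pi / m: the side lies on the geodesic
   { x | B(x, v_i) = 0 } at distance rho from the centre in direction
   2 pi i / n, where cosh rho = cos(pi/m) / sin(pi/n). *)
Definition side_normal (n m : nat) (i : 'I_n) : 'cV[R]_3 :=
  let C : R := cos (pi / (m%:R : R)) / sin (pi / (n%:R : R)) in
  let th : R := 2 * pi * ((i : nat)%:R : R) / (n%:R : R) in
  \col_(j < 3) (if (j : nat) == 0%N then Num.sqrt (C ^+ 2 - 1)
                else if (j : nat) == 1%N then C * cos th else C * sin th).

(* hyperbolic reflection in the geodesic orthogonal to the unit spacelike v: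
   x |-> x - 2 B(x,v)/B(v,v) v = x + 2 B(v,x) v *)
Definition refl (v : 'cV[R]_3) : 'M[R]_3 := 1%:M + 2 *: (v *m (v^T *m J3)).

Definition gen (n m : nat) (i : 'I_n) : 'M[R]_3 := refl (side_normal n m i).

Definition word_mat (n m : nat) (w : seq 'I_n) : 'M[R]_3 :=
  foldr (fun i M => gen n m i *m M) 1%:M w.

Definition Gamma (n m : nat) : set 'M[R]_3 :=
  [set g | exists w : seq 'I_n, g = word_mat n m w].

Definition trivial_stabilizer (n m : nat) (x0 : 'cV[R]_3) : Prop :=
  forall g, Gamma n m g -> g *m x0 = x0 -> g = 1%:M.

(* law of X_k = xi_1 ... xi_k, xi_i iid uniform on {r_1,..,r_n} *)
Definition mu_k (n m k : nat) (g : 'M[R]_3) : R :=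
  (#|[pred w : k.-tuple 'I_n | word_mat n m w == g]|)%:R / (n ^ k)%:R.

Definition entropy_k (n m k : nat) : R :=
  - \sum_(w : k.-tuple 'I_n) (n ^ k)%:R^-1 * ln (mu_k n m k (word_mat n m w)).

(* E[ d(e, X_k) ] with d(g,h) = d_{H^2}(g.x0, h.x0) *)
Definition drift_k (n m : nat) (x0 : 'cV[R]_3) (k : nat) : R :=
  \sum_(w : k.-tuple 'I_n) (n ^ k)%:R^-1 * hdist x0 (word_mat n m w *m x0).

Definition ball_card (n m : nat) (x0 : 'cV[R]_3) (k : nat) : nat :=
  #|` fset_set [set g | Gamma n m g /\ hdist x0 (g *m x0) <= k%:R] |%fset.


End HypCoxeter.

Arguments J3 {R}. Arguments mink {R}. Arguments inH2 {R}. Arguments hdist {R}.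
Arguments side_normal {R}. Arguments refl {R}. Arguments gen {R}.
Arguments word_mat {R}. Arguments Gamma {R}. Arguments trivial_stabilizer {R}.
Arguments mu_k {R}. Arguments drift_k {R}. Arguments ball_card {R}.

(* Main.v *)
(** With [o = (1,0,0)] the centre of the polygon, [cosh d(o, g o)] is the matrix entry [g 0 0], and
    the three invariants are estimated separately.

    Volume: the orbit of [o] is separated, by the positivity of roots in Coxeter groups, and
    cobounded; hence the number of [g] with [g 0 0 <= T] is linear in [T] up to a logarithm, and
    [v = 1].

    Entropy: the walk is the image of the walk on the free product of [n] groups of order two,
    so [h <= (n - 2) / n * ln (n - 1)].

    Drift: let [C = cos (pi / m) / sin (pi / n)] and [s] be the hyperbolic cosine and sine of the
    inradius.  By the factorisation of [X^n - 1], a reflection in a random side increases the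
    logarithm of the height of any point by at least [2 / n * ln (C^n - s^n)] on average, so this
    is a lower bound of [l].

    The drift bound exceeds the entropy bound for all [m] when [n >= 40], and for large [m] when
    [5 <= n < 40].  When [n = 4] both bounds tend to [ln 3 / 2] as [m] grows, and the drift has
    to be estimated over two consecutive steps. *)
Require Import Defs.
From HB Require Import structures.
From mathcomp Require Import all_boot all_order all_algebra.
From mathcomp Require Import all_classical all_reals all_analysis.
From mathcomp Require Import finmap complex ring lra zify.

Import Order.TTheory GRing.Theory Num.Theory.
Import numFieldNormedType.Exports.
Local Open Scope classical_set_scope.
Local Open Scope ring_scope.

Set Implicit Arguments.
Unset Strict Implicit.

(** * Subadditive sequences and elementary estimates *)

(** As [v = 1] exactly, it is enough to separate an upper bound of [h] from a lower bound of [l].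
    The bound of [l] grows like [2 ln n] and that of [h] like [ln n], so the difficulty lies in
    small [n]. Cleared of logarithms, the comparison reads [(n - 1)^(n - 2) < (C^n - s^n)^2]. The
    angle enters only through [C^2], which increases with [m] to [1 / sin (pi / n)^2]; for fixed
    [n], a threshold on [C^2] below this limit that implies the inequality leaves only finitely many
    [m] aside. At [n = 4] the limit values [C^2 = 2] and [s^2 = 1] give [9 = 9].

    [Gamma] is a group of matrices generated by explicit reflections, so its discreteness has to be
    derived from them. The sign of a root is read off its coordinate of index 0, its product with
    the origin: it tells on which side of the mirror the origin lies. All counting and averaging is
    done at the origin; moving the base point to [x0] changes distances by a bounded amount. *)

Lemma subadditive_cvg (R : realType) (a : nat -> R) :
  (forall k, 0 <= a k) -> (forall i j, a (i + j)%N <= a i + a j) ->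
  exists2 l : R, (fun k : nat => a k / k%:R) @ \oo --> l &
    forall k, (0 < k)%N -> l <= a k / k%:R.
Proof.
move=> a0 aD.
pose E := [set a k / k%:R | k in [set k | (0 < k)%N]].
have lbE : has_lbound E.
  by exists 0 => _ [k _ <-]; rewrite divr_ge0.
have infE : has_inf E by split => //; exists (a 1%N / 1%:R), 1%N.
have leE k : (0 < k)%N -> inf E <= a k / k%:R.
  by move=> k0; apply: ge_inf => //; exists k.
exists (inf E) => //.
apply/cvgrPdist_le => e e0.
have e20 : 0 < e / 2 by rewrite divr_gt0.
have [_ [p /= p0 <-] ap] := inf_adherent e20 infE.
pose M := \sum_(i < p) a i.
(* Euclidean division by [p], fixed with [a p / p] near the infimum; [M] bounds the contribution of
   every remainder. *)
have aM k : a k <= (k %/ p)%:R * a p + M.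
  have aq q r : a (q * p + r)%N <= q%:R * a p + a r.
    elim: q => [|q IH]; first by rewrite mul0n add0n mul0r add0r.
    rewrite mulSn -addnA (le_trans (aD _ _))// -natr1 mulrDl mul1r.
    by rewrite [_ * a p + _]addrC -addrA lerD2l.
  rewrite {1}(divn_eq k p) (le_trans (aq _ _))// lerD2l.
  have kp : (k %% p < p)%N by rewrite ltn_mod.
  by rewrite /M (bigD1 (Ordinal kp))//= lerDl sumr_ge0.
have M0 : 0 <= M by rewrite sumr_ge0.
near=> k.
have k0 : (0 < k)%N by near: k; exists 1%N.
have kR : 0 < k%:R :> R by rewrite ltr0n.
rewrite ler0_norm ?subr_le0 ?leE// opprB lerBlDr.
have Mk : M / k%:R <= e / 2.
  rewrite ler_pdivrMr// mulrC -ler_pdivrMr//.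
  near: k; exists (Num.truncn (M / (e / 2))).+1 => // k /= hk.
  by apply/ltW/(lt_le_trans (truncnS_gt _)); rewrite ler_nat.
have pR : 0 < p%:R :> R by rewrite ltr0n.
rewrite ler_pdivrMr// (le_trans (aM k))//.
have kp : (k %/ p)%:R <= k%:R / p%:R :> R.
  by rewrite ler_pdivlMr// -natrM ler_nat leq_divM.
have : (k %/ p)%:R * a p <= (inf E + e / 2) * k%:R.
  rewrite (le_trans (ler_wpM2r (a0 p) kp))// -mulrA mulrC ler_wpM2r//.
  by rewrite mulrC ltW.
move: Mk; rewrite ler_pdivrMr// => Mk.
lra.
Unshelve. all: by end_near. Qed.

Lemma cvg_div_nat_bounded (R : realType) (u v : nat -> R) (K l : R) :
  (forall k, `|u k - v k| <= K) ->
  (fun k : nat => u k / k%:R) @ \oo --> l ->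
  (fun k : nat => v k / k%:R) @ \oo --> l.
Proof.
move=> uvK ul.
have K0 : 0 <= K by apply: le_trans (uvK 0%N).
apply/cvgrPdist_le => e e0.
have e20 : 0 < e / 2 by rewrite divr_gt0.
have /cvgrPdist_le/(_ _ e20) ul2 := ul.
near=> k.
have k0 : (0 < k)%N by near: k; exists 1%N.
have kR : 0 < k%:R :> R by rewrite ltr0n.
have Kk : K / k%:R <= e / 2.
  rewrite ler_pdivrMr// mulrC -ler_pdivrMr//.
  near: k; exists (Num.truncn (K / (e / 2))).+1 => // k /= hk.
  by apply/ltW/(lt_le_trans (truncnS_gt _)); rewrite ler_nat.
have -> : l - v k / k%:R = (l - u k / k%:R) + (u k - v k) / k%:R by field; lra.
rewrite (le_trans (ler_normD _ _))// (splitr e) lerD//; first by near: k.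
by rewrite normf_div normr_nat (le_trans _ Kk)// ler_wpM2r ?invr_ge0.
Unshelve. all: by end_near. Qed.

Lemma cvg_ln_affine (R : realType) (a b : R) : 0 <= a -> 1 <= b ->
  (fun k : nat => ln (a * k%:R + b) / k%:R) @ \oo --> (0 : R).
Proof.
move=> a0 b1; apply/cvgrPdist_le => e e0.
near=> k.
have k0 : (0 < k)%N by near: k; exists 1%N.
have kR : 1 <= k%:R :> R by rewrite ler1n.
have akb : 1 <= a * k%:R + b by rewrite -[leLHS]add0r lerD// mulr_ge0.
rewrite sub0r normrN ger0_norm; last by rewrite divr_ge0// ln_ge0.
rewrite ler_pdivrMr; last lra.
(* Applying [ln y < y] to the square root gives [ln (a k + b) <= 2 sqrt (a k + b)], which is
   sublinear in [k]. *)
pose y := Num.sqrt (a * k%:R + b).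
have y0 : 0 < y by rewrite sqrtr_gt0; lra.
have yE : y ^+ 2 = a * k%:R + b by rewrite sqr_sqrtr//; lra.
rewrite -yE lnXn//.
have lny := ltW (ln_sublinear y0).
suff : 2 * y <= e * k%:R by rewrite -mulr_natl => ?; lra.
have ab : 4 * (a + b) <= e ^+ 2 * k%:R.
  rewrite mulrC [leRHS]mulrC -ler_pdivrMr ?exprn_gt0//.
  near: k; exists (Num.truncn ((a + b) * 4 / e ^+ 2)).+1 => // k /= hk.
  by apply/ltW/(lt_le_trans (truncnS_gt _)); rewrite ler_nat.
rewrite -(@ler_pXn2r _ 2)// ?nnegrE ?mulr_ge0//; try lra.
rewrite !exprMn yE.
have -> : e ^+ 2 * k%:R ^+ 2 = (e ^+ 2 * k%:R) * k%:R by ring.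
have : b <= b * k%:R by rewrite ler_peMr//; lra.
have : (4 * (a + b)) * k%:R <= e ^+ 2 * k%:R * k%:R by rewrite ler_wpM2r//; lra.
nra.
Unshelve. all: by end_near. Qed.

Lemma ler_nonneg_derive (R : realType) (f df : R -> R) (x : R) : 0 <= x ->
  (forall y, is_derive y (1 : R) f (df y)) -> (forall y, 0 <= y -> 0 <= df y) ->
  f 0 <= f x.
Proof.
move=> x0 fd df0.
have cf : {within `[0, x], continuous f}.
  by apply: derivable_within_continuous => y _; case: (fd y).
have [c cx H] := MVT_segment x0 (fun y _ => fd y) cf.
rewrite -subr_ge0 H mulr_ge0 ?df0//; last by rewrite subr0.
by move: cx; rewrite in_itv/= => /andP[].
Qed.

Lemma sin_le_id (R : realType) (x : R) : 0 <= x -> sin x <= x.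
Proof.
move=> x0; rewrite -subr_ge0.
have := @ler_nonneg_derive R (fun y => y - sin y) (fun y => 1 - cos y) x x0.
by rewrite sin0 subr0; apply => // y _; rewrite subr_ge0 cos_le1.
Qed.

Lemma cos_ge_deg2 (R : realType) (x : R) : 1 - x ^+ 2 / 2 <= cos x.
Proof.
wlog x0 : x / 0 <= x.
  move=> H; have [/H//|x0] := leP 0 x.
  by have := H (- x); rewrite cosN sqrrN; apply; lra.
rewrite -subr_ge0.
have := @ler_nonneg_derive R (fun y => cos y - (1 - y ^+ 2 / 2))
  (fun y => y - sin y) x x0.
rewrite cos0 expr0n/= mul0r subr0 subrr; apply => y.
  apply: is_derive_eq; rewrite /GRing.scale/=; lra.
by move=> y0; rewrite subr_ge0 sin_le_id.
Qed.

Lemma sin_ge_deg3 (R : realType) (x : R) : 0 <= x -> x - x ^+ 3 / 6 <= sin x.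
Proof.
move=> x0; rewrite -subr_ge0.
have := @ler_nonneg_derive R (fun y => sin y - (y - y ^+ 3 / 6))
  (fun y => cos y - (1 - y ^+ 2 / 2)) x x0.
rewrite sin0 expr0n/= mul0r !subr0; apply => y.
  apply: is_derive_eq; rewrite /GRing.scale/=; lra.
by move=> y0; rewrite subr_ge0 cos_ge_deg2.
Qed.

Lemma cos_le_deg4 (R : realType) (x : R) : cos x <= 1 - x ^+ 2 / 2 + x ^+ 4 / 24.
Proof.
wlog x0 : x / 0 <= x.
  move=> H; have [/H//|x0] := leP 0 x.
  have := H (- x); rewrite cosN sqrrN.
  have -> : (- x) ^+ 4 = x ^+ 4 by ring.
  apply; lra.
rewrite -subr_ge0.
have := @ler_nonneg_derive R (fun y => 1 - y ^+ 2 / 2 + y ^+ 4 / 24 - cos y)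
  (fun y => sin y - (y - y ^+ 3 / 6)) x x0.
rewrite cos0 !expr0n/= !mul0r !subr0 addr0 subrr; apply => y.
  apply: is_derive_eq; rewrite /GRing.scale/=; lra.
by move=> y0; rewrite subr_ge0 sin_ge_deg3.
Qed.

(** The quartic bound of the cosine is already negative at [8 / 5], which therefore exceeds
    [pi / 2]. The constant [16 / 5] is the source of most numerical thresholds below. *)
Lemma pi_lt_16_5 (R : realType) : (pi : R) < 16 / 5.
Proof.
rewrite ltNge; apply/negP => h.
have : 0 <= cos (8 / 5 : R) by apply: cos_ge0_pihalf; apply/andP; split; lra.
have := cos_le_deg4 (8 / 5 : R).
lra.
Qed.

(** * Entropy *)

(** [F] takes sequences rather than tuples, so that words can be split and concatenated under the
    expectation without casts. *)
Definition avg (R : realType) (n k : nat) (F : seq 'I_n -> R) : R :=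
  \sum_(w : k.-tuple 'I_n) (n ^ k)%:R^-1 * F w.

Lemma sum_tuple0 (R : nmodType) (T : finType) (F : seq T -> R) :
  \sum_(w : 0.-tuple T) F w = F [::].
Proof.
rewrite (bigD1 [tuple])//= big1 ?addr0// => w /eqP[].
by apply: val_inj; case: w => -[].
Qed.

Lemma sum_tupleS (R : nmodType) (T : finType) (k : nat) (F : seq T -> R) :
  \sum_(w : k.+1.-tuple T) F w = \sum_(i : T) \sum_(w : k.-tuple T) F (i :: w).
Proof.
rewrite pair_big/=.
rewrite (reindex (fun p : T * k.-tuple T => [tuple of p.1 :: p.2]))//=.
exists (fun w : k.+1.-tuple T => (thead w, [tuple of behead w])) => [[i w] _|w _] /=.
  by congr pair; apply: val_inj.
by rewrite [RHS]tuple_eta.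
Qed.

Section Average.
Variables (R : realType) (n : nat).
Hypothesis n0 : (0 < n)%N.
Implicit Types (F G : seq 'I_n -> R).

Lemma avg0 F : avg 0 F = F [::].
Proof. by rewrite /avg -mulr_sumr (sum_tuple0 F) expn0 invr1 mul1r. Qed.

Lemma avgS k F : avg k.+1 F = n%:R^-1 * \sum_i avg k (fun w => F (i :: w)).
Proof.
rewrite /avg -!mulr_sumr (sum_tupleS _ F).
under [in RHS]eq_bigr do rewrite -mulr_sumr.
by rewrite -mulr_sumr mulrA expnS natrM invfM.
Qed.

Lemma avg_sum (I : Type) (r : seq I) (P : pred I) k (F : I -> seq 'I_n -> R) :
  avg k (fun w => \sum_(i <- r | P i) F i w) = \sum_(i <- r | P i) avg k (F i).
Proof. by rewrite /avg exchange_big/=; apply: eq_bigr => w _; rewrite mulr_sumr. Qed.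

Lemma avgZ k c F : avg k (fun w => c * F w) = c * avg k F.
Proof. by rewrite /avg mulr_sumr; apply: eq_bigr => w _; rewrite mulrCA. Qed.

Lemma avgD k F G : avg k (fun w => F w + G w) = avg k F + avg k G.
Proof. by rewrite /avg -big_split/=; apply: eq_bigr => w _; rewrite mulrDr. Qed.

Lemma avg_cst k (c : R) : avg k (fun _ : seq 'I_n => c) = c.
Proof.
rewrite /avg sumr_const card_tuple card_ord -[LHS]mulr_natl mulrA divff ?mul1r//.
by rewrite pnatr_eq0 -lt0n expn_gt0 n0.
Qed.

Lemma le_avg k F G : (forall w, size w = k -> F w <= G w) -> avg k F <= avg k G.
Proof.
by move=> FG; apply: ler_sum => w _; rewrite ler_wpM2l ?invr_ge0// FG// size_tuple.
Qed.

Lemma eq_avg k F G : (forall w, size w = k -> F w = G w) -> avg k F = avg k G.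
Proof. by move=> FG; apply: eq_bigr => w _; rewrite FG// size_tuple. Qed.

Lemma avg_ge0 k F : (forall w, size w = k -> 0 <= F w) -> 0 <= avg k F.
Proof. by move=> F0; rewrite -(avg_cst k 0); apply: le_avg. Qed.

Lemma avg_cat j k F :
  avg (j + k) F = avg j (fun u => avg k (fun w => F (u ++ w))).
Proof.
elim: j F => [|j IH] F; first by rewrite avg0.
by rewrite addSn !avgS; congr *%R; apply: eq_bigr => i _; rewrite IH.
Qed.

(** Products are folded from the right, so the head of a word acts last. Recursions on [k] thus
    follow the walk [xi_k ... xi_1], which has the law of [X_k] for each fixed [k]. *)
Lemma avgS_last k F :
  avg k.+1 F = avg k (fun w => n%:R^-1 * \sum_i F (i :: w)).
Proof. by rewrite avgS avgZ avg_sum. Qed.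

End Average.

Section WordMatrices.
Variables (R : realType) (n m : nat).
Implicit Types (u w : seq 'I_n).

Lemma word_mat_cat u w :
  word_mat n m (u ++ w) = word_mat n m u *m word_mat n m w :> 'M[R]_3.
Proof. by elim: u => [|i u IH]/=; rewrite ?mul1mx// IH mulmxA. Qed.

Lemma word_mat_rcons u i :
  word_mat n m (rcons u i) = word_mat n m u *m gen n m i :> 'M[R]_3.
Proof. by rewrite -cats1 word_mat_cat/= mulmx1. Qed.

End WordMatrices.

Section Entropy.
Variables (R : realType) (n m : nat).
Hypothesis n0 : (0 < n)%N.

Lemma mu_kE k (g : 'M[R]_3) :
  mu_k n m k g = avg k (fun w => (word_mat n m w == g)%:R).
Proof.
rewrite /mu_k /avg -mulr_sumr mulrC -sum1_card natr_sum big_mkcond/=.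
by congr *%R; apply: eq_bigr => w _; rewrite inE; case: eqP.
Qed.

Lemma mu_k_le1 k (g : 'M[R]_3) : mu_k n m k g <= 1.
Proof.
by rewrite mu_kE -[leRHS](avg_cst n0 k); apply: le_avg => w _; case: eqP.
Qed.

Lemma avg_indicator_gt0 (T : eqType) (f : seq 'I_n -> T) w :
  0 < avg (size w) (fun u => (f u == f w)%:R) :> R.
Proof.
rewrite /avg (bigD1 (in_tuple w))//= eqxx mulr1.
apply: ltr_pwDl; first by rewrite invr_gt0 ltr0n expn_gt0 n0.
by apply: sumr_ge0 => u _; rewrite mulr_ge0 ?invr_ge0.
Qed.

Lemma mu_k_gt0 w : 0 < mu_k n m (size w) (word_mat n m w) :> R.
Proof. by rewrite mu_kE; apply: avg_indicator_gt0. Qed.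

Lemma mu_kM j k (g h : 'M[R]_3) :
  mu_k n m j g * mu_k n m k h <= mu_k n m (j + k) (g *m h).
Proof.
rewrite !mu_kE avg_cat mulrC -avgZ; apply: le_avg => u _.
rewrite mulrC -avgZ; apply: le_avg => w _.
rewrite word_mat_cat; case: eqP => [->|_]; last by rewrite mul0r.
by case: eqP => [->|_]; rewrite ?eqxx ?mulr1 ?mulr0.
Qed.

Lemma entropy_kE k :
  @entropy_k R n m k = avg k (fun w => - ln (mu_k n m k (word_mat n m w))).
Proof.
by rewrite /entropy_k -sumrN; apply: eq_bigr => w _; rewrite mulrN.
Qed.

Lemma entropy_k_ge0 k : 0 <= @entropy_k R n m k.
Proof.
by rewrite entropy_kE; apply: avg_ge0 => // w _; rewrite oppr_ge0 ln_le0// mu_k_le1.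
Qed.

(** Holds word by word: by [mu_kM], [- ln mu_k] is subadditive under concatenation, and the two
    parts of a random word are independent. *)
Lemma entropy_kD j k :
  @entropy_k R n m (j + k) <= @entropy_k R n m j + @entropy_k R n m k.
Proof.
rewrite !entropy_kE avg_cat.
have -> : forall c, avg j (fun w => - ln (mu_k n m j (word_mat n m w))) + c =
  avg j (fun w => - ln (mu_k n m j (word_mat n m w)) + c) :> R.
  by move=> c; rewrite avgD avg_cst.
apply: le_avg => u hu.
rewrite -[X in X + _](avg_cst n0 k) -avgD; apply: le_avg => w hw.
have mu0 := mu_k_gt0 u; have mw0 := mu_k_gt0 w.
rewrite -opprD lerN2 -hu -hw -lnM ?posrE//.
have muw0 : 0 < mu_k n m (size u + size w) (word_mat n m (u ++ w)) :> R.
  by rewrite -size_cat; apply: mu_k_gt0.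
have mm0 := mulr_gt0 mu0 mw0.
by rewrite ler_ln ?posrE// word_mat_cat mu_kM.
Qed.

End Entropy.

(** * Free reduction of words and the entropy of the free product *)

Section FreeReduction.
Variable T : eqType.
Implicit Types (u w : seq T) (i : T).

(** Letters are involutions, so the normal forms of the free product are the words without equal
    neighbours; a prepended letter either cancels the head or extends the word. *)
Definition cons_red i u := if u is a :: u' then if i == a then u' else i :: u else [:: i].
Definition red w := foldr cons_red [::] w.
Definition reduced u := sorted (fun a b => a != b) u.

Lemma reduced_cons i u : reduced (i :: u) -> reduced u.
Proof. exact: path_sorted. Qed.

Lemma reduced_red w : reduced (red w).
Proof.
elim: w => //= i w; rewrite /cons_red; case: (red w) => // a u.
by case: eqVneq => [_|ia] /= h; [exact: reduced_cons h|rewrite /= ia].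
Qed.

Lemma size_red w : (size (red w) <= size w)%N.
Proof.
elim: w => //= i w; rewrite /cons_red; case: (red w) => // a u.
by case: eqVneq => [_|ia] /= h; [apply: leq_trans (ltnW h) _; apply: leqnSn|].
Qed.
End FreeReduction.

Lemma sum_neq (R : pzRingType) (n : nat) (a : 'I_n) :
  \sum_(i < n) (i != a)%:R = n%:R - 1 :> R.
Proof.
rewrite (eq_bigr (fun i => 1 - (i == a)%:R)); last first.
  by move=> i _; case: eqP; rewrite ?subrr ?subr0.
by rewrite sumrB sumr_const card_ord (bigD1 a)//= eqxx big1 ?addr0// => i /negPf ->.
Qed.

Section FreeEntropy.
Variables (R : realType) (n m : nat).
Hypothesis n3 : (3 < n)%N.

Let n0 : (0 < n)%N. Proof. exact: leq_trans n3. Qed.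
Let nn0 : n%:R != 0 :> R. Proof. by rewrite pnatr_eq0 -lt0n. Qed.
Let n1n0 : n%:R - 1 != 0 :> R. Proof. by rewrite subr_eq0 -[1]/(1%:R) eqr_nat; lia. Qed.

Lemma card_reduced j :
  \sum_(u : j.+1.-tuple 'I_n) (reduced u)%:R = n%:R * (n%:R - 1) ^+ j :> R.
Proof.
elim: j => [|j IH].
  rewrite (sum_tupleS _ (fun u => (reduced u)%:R)).
  under eq_bigr do rewrite (sum_tuple0 (fun u => (reduced (_ :: u))%:R)).
  by rewrite /= sumr_const card_ord mulr1.
rewrite (sum_tupleS _ (fun u => (reduced u)%:R)) exchange_big/= exprSr mulrA -IH mulr_suml.
apply: eq_bigr => u _; case: (tupleP u) => a u' /=.
rewrite -(sum_neq R a) mulr_sumr; apply: eq_bigr => i _ /=.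
by rewrite -mulnb natrM mulrC.
Qed.

(* The size of the reduced word increases by [(n - 2) / n] on average, except at the empty word;
   adding [2 ^- size] to it absorbs this exception. *)
Lemma avg_size_red k :
  avg k (fun w : seq 'I_n => (size (red w))%:R) <= 1 + k%:R * ((n%:R - 2) / n%:R) :> R.
Proof.
have nR : 4 <= n%:R :> R by rewrite ler_nat.
pose V L : R := L%:R + 2^-1 ^+ L.
have VL L : L%:R <= V L by rewrite lerDl exprn_ge0.
apply: (@le_trans _ _ (avg k (fun w : seq 'I_n => V (size (red w))))).
  exact: le_avg.
elim: k => [|k IH]; first by rewrite avg0/= /V !mul0r add0r expr0 addr0.
rewrite avgS_last.
apply: (@le_trans _ _ (avg k (fun w : seq 'I_n =>
    V (size (red w)) + (n%:R - 2) / n%:R))).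
  apply: le_avg => w _ /=; case: (red w) => [|a u] /=.
    rewrite sumr_const card_ord -[V 1%N *+ n]mulr_natl mulrA mulVf// mul1r.
    rewrite /V expr0 expr1 add0r -lerBlDl ler_pdivlMr; lra.
  rewrite (eq_bigr (fun i : 'I_n => V (size u) + (i != a)%:R * (V (size u).+2 - V (size u)))).
    rewrite big_split/= -mulr_suml sum_neq sumr_const card_ord -[V (size u) *+ n]mulr_natl.
    rewrite mulrC ler_pdivrMr; last lra.
    rewrite [leRHS]mulrDl divfK//.
    rewrite /V !exprS; have : 0 <= (2^-1 : R) ^+ size u by rewrite exprn_ge0.
    rewrite -(natr1 (size u).+1) -(natr1 (size u)); set p := _ ^+ _; set s := (size u)%:R => p0.
    have : 0 <= p * (n%:R - 3) by rewrite mulr_ge0//; lra.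
    have : 0 <= 2^-1 * p * (n%:R - 3) by rewrite mulr_ge0 ?mulr_ge0//; lra.
    nra.
  by move=> i _; case: (eqVneq i a) => _ /=; rewrite ?mul0r ?addr0// mul1r addrC subrK.
by rewrite avgD avg_cst// -(natr1 k) (mulrDl k%:R) mul1r addrA lerD2r.
Qed.

Hypothesis genK : forall i : 'I_n, gen n m i *m gen n m i = 1%:M :> 'M[R]_3.

Lemma word_mat_red w : word_mat n m (red w) = word_mat n m w :> 'M[R]_3.
Proof.
elim: w => //= i w <-; rewrite /cons_red; case: (red w) => //= a u.
by case: eqVneq => //= ->; rewrite mulmxA genK mul1mx.
Qed.

(* Gibbs' inequality against the weights [(n - 1) ^- size u] on the reduced words [u], whose
   total mass up to size [k] is at most [2 k + 1]. *)
Lemma entropy_k_free k :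
  @entropy_k R n m k <=
  (1 + k%:R * ((n%:R - 2) / n%:R)) * ln (n%:R - 1) + ln (2 * k%:R + 1).
Proof.
have nR : 4 <= n%:R :> R by rewrite ler_nat.
pose nu u : R := avg k (fun w : seq 'I_n => (red w == u)%:R).
pose q j : R := (n%:R - 1) ^- j.
have q0 j : 0 < q j by rewrite invr_gt0 exprn_gt0//; lra.
pose Z : R := 2 * k%:R + 1.
have Z0 : 0 < Z by rewrite ltr_pwDr// mulr_ge0.
have nu0 w : size w = k -> 0 < nu (red w) by rewrite /nu => <-; exact: avg_indicator_gt0.
(* The mean of [q / nu] under the law [nu] of the reduced word is the sum of [q] over the words
   charged by [nu], hence at most the sum over all reduced words of size up to [k]. *)
have mass : avg k (fun w : seq 'I_n => q (size (red w)) / nu (red w)) <= Z.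
  have -> : avg k (fun w : seq 'I_n => q (size (red w)) / nu (red w)) =
    avg k (fun w : seq 'I_n => \sum_(j < k.+1) \sum_(u : j.-tuple 'I_n)
       (reduced u)%:R * (q j / nu u) * (red w == u)%:R).
    apply: eq_avg => w hw.
    have hs : (size (red w) < k.+1)%N by rewrite ltnS (leq_trans (size_red w))// hw.
    rewrite (bigD1 (Ordinal hs))//= (bigD1 (in_tuple (red w)))//= reduced_red eqxx mul1r mulr1.
    rewrite !big1 ?addr0//.
      move=> j jr; rewrite big1// => u _; case: eqP => [ru|_]; last by rewrite mulr0.
      by move: jr; rewrite -val_eqE/= ru size_tuple eqxx.
    move=> u; rewrite -val_eqE/= eq_sym => /negPf ->; by rewrite mulr0.
  rewrite avg_sum; apply: (@le_trans _ _ (\sum_(j < k.+1) \sum_(u : j.-tuple 'I_n)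
     (reduced u)%:R * q j)).
    apply: ler_sum => j _; rewrite avg_sum; apply: ler_sum => u _.
    rewrite avgZ -/(nu u) -mulrA ler_wpM2l//.
    have [->|nuu] := eqVneq (nu u) 0; first by rewrite mulr0 ltW.
    by rewrite divfK.
  rewrite big_ord_recl (sum_tuple0 (fun u => (reduced u)%:R * q 0%N)) /= mul1r /q expr0 invr1.
  rewrite addrC /Z lerD2r -[k in leRHS]card_ord -sum1_card natr_sum mulr_sumr; apply: ler_sum => j _.
  rewrite /bump/= add1n -mulr_suml card_reduced exprS.
  have p0 : (n%:R - 1) ^+ j != 0 :> R by rewrite expf_neq0.
  have -> : n%:R * (n%:R - 1) ^+ j / ((n%:R - 1) * (n%:R - 1) ^+ j) = n%:R / (n%:R - 1) :> R.
    by field; rewrite p0 n1n0.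
  rewrite ler_pdivrMr; lra.
have -> : (1 + k%:R * ((n%:R - 2) / n%:R)) * ln (n%:R - 1) + ln (2 * k%:R + 1) =
    ln (n%:R - 1) * (1 + k%:R * ((n%:R - 2) / n%:R)) + ln Z + (Z^-1 * Z - 1).
  by rewrite mulVf ?gt_eqF// subrr addr0 mulrC.
apply: (@le_trans _ _ (avg k (fun w : seq 'I_n => ln (n%:R - 1) * (size (red w))%:R + ln Z
     + (Z^-1 * (q (size (red w)) / nu (red w)) - 1)))).
  rewrite entropy_kE; apply: le_avg => w hw.
  have nw := nu0 w hw.
  (* Several reduced words may have the same matrix, so passing to the group only increases
     probabilities. *)
  have muw : nu (red w) <= mu_k n m k (word_mat n m w).
    rewrite mu_kE; apply: le_avg => v _.
    case: eqP => [rv|_]; last by case: eqP.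
    by rewrite -(word_mat_red v) rv word_mat_red eqxx.
  set t := Z^-1 * _.
  have t0 : 0 < t by apply: mulr_gt0; [rewrite invr_gt0|exact: divr_gt0].
  have lnt : ln t <= t - 1.
    have := @le_ln1Dx R (t - 1); rewrite (addrC 1) subrK; apply; lra.
  have lntE : ln t = - ln Z - ln (n%:R - 1) * (size (red w))%:R - ln (nu (red w)).
    rewrite /t mulrC !ln_div ?posrE ?divr_gt0//.
    rewrite /q lnV ?posrE ?exprn_gt0//; last lra.
    rewrite lnXn; last lra.
    rewrite -mulr_natr; lra.
  have : ln (nu (red w)) <= ln (mu_k n m k (word_mat n m w)).
    by rewrite ler_ln ?posrE// (lt_le_trans nw).
  lra.
rewrite !avgD !avgZ !avg_cst// lerD//.
  rewrite lerD2r ler_wpM2l ?avg_size_red// ln_ge0//; lra.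
by rewrite lerD2r ler_wpM2l ?invr_ge0 ?(ltW Z0).
Qed.

Lemma entropy_cvg :
  exists2 h : R, (fun k : nat => @entropy_k R n m k / k%:R) @ \oo --> h &
    h <= (n%:R - 2) / n%:R * ln (n%:R - 1).
Proof.
have [h hh hle] := subadditive_cvg (entropy_k_ge0 R m n0) (entropy_kD R m n0).
exists h => //.
have fin (A B L K E P : R) : B + P <= E * K -> L <= P ->
    (1 + K * A) * L + B <= (A * L + E) * K by lra.
have nR : 4 <= n%:R :> R by rewrite ler_nat.
(* The error terms are [ln (2 k + 1) / k] and [ln (n - 1) / k]; the bound [1 / k <= 2 / (k + 1)]
   brings in the harmonic sequence. *)
have lim0 : (fun k : nat => ln (2 * k%:R + 1) / k%:R + (k.+1%:R)^-1 * (2 * ln (n%:R - 1))) @ \oo --> (0 : R).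
  have -> : 0 = 0 + 0 * (2 * ln (n%:R - 1)) :> R by rewrite mul0r addr0.
  apply: cvgD; first exact: cvg_ln_affine.
  by apply: cvgMr_tmp; exact: cvg_harmonic.
apply/ler_addgt0Pr => e e0.
move/cvgrPdist_le: lim0 => /(_ _ e0) [N _ HN].
have := HN N.+1 (leqnSn N); rewrite sub0r normrN => /(le_trans (ler_norm _)) He.
apply: le_trans (hle N.+1 isT) _.
have k0 : 0 < N.+1%:R :> R by rewrite ltr0n.
rewrite ler_pdivrMr// (le_trans (entropy_k_free _))//.
have {}He : (ln (2 * N.+1%:R + 1) / N.+1%:R + N.+2%:R^-1 * (2 * ln (n%:R - 1))) * N.+1%:R <= e * N.+1%:R.
  by rewrite ler_wpM2r// ltW.
rewrite mulrDl divfK ?gt_eqF// in He.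
have L0 : 0 <= ln (n%:R - 1) :> R by rewrite ln_ge0//; lra.
have : ln (n%:R - 1) <= N.+2%:R^-1 * (2 * ln (n%:R - 1)) * N.+1%:R :> R.
  have -> : N.+2%:R^-1 * (2 * ln (n%:R - 1)) * N.+1%:R =
      ln (n%:R - 1) * (2 * N.+1%:R) / N.+2%:R :> R by ring.
  by rewrite ler_pdivlMr ?ltr0n// ler_wpM2l// -natrM ler_nat; lia.
exact: fin He.
Qed.

End FreeEntropy.

(** * The reflections of the hyperboloid *)

Section Minkowski.
Variable R : realType.
Implicit Types (x y z p q : 'cV[R]_3) (M : 'M[R]_3).

Definition origin : 'cV[R]_3 := delta_mx 0 0.

Lemma minkE x y :
  mink x y = x 0 0 * y 0 0 - x 1 0 * y 1 0 - x 2%:R 0 * y 2%:R 0.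
Proof.
have e1 : lift ord0 ord0 = 1 :> 'I_3 by apply: val_inj.
have e2 : lift ord0 (lift ord0 ord0) = 2%:R :> 'I_3 by apply: val_inj.
rewrite /mink !mxE !big_ord_recl !big_ord0 !mxE !big_ord_recl !big_ord0.
by rewrite !mxE /= !e1 !e2 -[ord0]/(0 : 'I_3); ring.
Qed.

Lemma mink_sym x y : mink x y = mink y x.
Proof. by rewrite !minkE; ring. Qed.

Lemma minkDr x y z : mink x (y + z) = mink x y + mink x z.
Proof. by rewrite !minkE !mxE; ring. Qed.

Lemma minkZr a x y : mink x (a *: y) = a * mink x y.
Proof. by rewrite !minkE !mxE; ring. Qed.

Lemma minkDl x y z : mink (x + y) z = mink x z + mink y z.
Proof. by rewrite !minkE !mxE; ring. Qed.

Lemma minkZl a x y : mink (a *: x) y = a * mink x y.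
Proof. by rewrite !minkE !mxE; ring. Qed.

Lemma mink_origin x : mink origin x = x 0 0.
Proof. by rewrite minkE !mxE /=; ring. Qed.

Lemma origin_H2 : inH2 origin.
Proof. by split; rewrite ?mink_origin !mxE. Qed.

Lemma mulmx_origin M : (M *m origin) 0 0 = M 0 0.
Proof. by rewrite -colE mxE. Qed.

Lemma mulmx_ext (A B : 'M[R]_3) : (forall x : 'cV[R]_3, A *m x = B *m x) -> A = B.
Proof.
move=> AB; apply/matrixP => i j; have := AB (delta_mx j 0).
by rewrite -!colE => /matrixP/(_ i 0); rewrite !mxE.
Qed.

Lemma refl_mul (v x : 'cV[R]_3) : refl v *m x = x + (2 * mink v x) *: v.
Proof.
rewrite /refl mulmxDl mul1mx -scalemxAl -mulmxA [v^T *m J3 *m x]mx11_scalar.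
by rewrite mul_mx_scalar scalerA.
Qed.

Lemma mink_refl (v x y : 'cV[R]_3) : mink v v = -1 ->
  mink (refl v *m x) (refl v *m y) = mink x y.
Proof.
move=> v1; rewrite !refl_mul !minkDl !minkDr !minkZl !minkZr v1 (mink_sym x v).
by ring.
Qed.

Lemma reflK (v : 'cV[R]_3) : mink v v = -1 -> refl v *m refl v = 1%:M.
Proof.
move=> v1; apply: mulmx_ext => x.
rewrite -mulmxA !refl_mul mul1mx minkDr minkZr v1 -addrA -scalerDl.
by rewrite (_ : 2 * mink v x + _ = 0) ?scale0r ?addr0//; ring.
Qed.

(** The matrix determinant lemma [det (1 + 2 v w) = 1 + 2 w v], read off two factorisations of one
    bordered matrix. Determinants will detect the parity of word lengths. *)
Lemma det_refl (v : 'cV[R]_3) : mink v v = -1 -> \det (refl v) = -1.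
Proof.
move=> v1; pose w := v^T *m J3.
have wv : w *m v = (-1)%:M by rewrite [LHS]mx11_scalar -v1.
have E1 : block_mx 1%:M (- 2 *: v) w 1%:M =
    block_mx 1%:M 0 w 1%:M *m block_mx 1%:M (- 2 *: v) 0 (- 1%:M) :> 'M[R]_(3 + 1).
  rewrite mulmx_block ?(mul1mx, mul0mx, mulmx0, mulmx1, addr0, add0r).
  congr block_mx; rewrite -scalemxAr wv; apply/matrixP => i j.
  by rewrite !mxE !ord1 eqxx; ring.
have E2 : block_mx 1%:M (- 2 *: v) w 1%:M =
    block_mx 1%:M (- 2 *: v) 0 1%:M *m block_mx (refl v) 0 w 1%:M :> 'M[R]_(3 + 1).
  rewrite mulmx_block ?(mul1mx, mul0mx, mulmx0, mulmx1, addr0, add0r).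
  congr block_mx; rewrite /refl -/w -scalemxAl scaleNr -addrA addrN addr0 //.
have : \det (block_mx 1%:M (- 2 *: v) w 1%:M : 'M[R]_(3 + 1)) = -1.
  rewrite E1 det_mulmx det_lblock det_ublock !det1 !mul1r -scaleN1r detZ det1.
  by rewrite expr1 mulr1.
by rewrite E2 det_mulmx det_ublock det_lblock !det1 !mul1r mulr1.
Qed.

Lemma inH2P x : inH2 x ->
  0 < x 0 0 /\ x 0 0 ^+ 2 = 1 + x 1 0 ^+ 2 + x 2%:R 0 ^+ 2.
Proof. by case=> + x0; rewrite minkE => h; split => //; lra. Qed.

Lemma inH2_ge1 x : inH2 x -> 1 <= x 0 0.
Proof.
move=> /inH2P[x0 xE]; rewrite -(@ler_pXn2r _ 2)// ?nnegrE//; last lra.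
by rewrite xE expr1n; have := sqr_ge0 (x 1 0); have := sqr_ge0 (x 2%:R 0); lra.
Qed.

Lemma inH2_norm_le x : inH2 x -> `|x 1 0| <= x 0 0 /\ `|x 2%:R 0| <= x 0 0.
Proof.
move=> /inH2P[x0 xE].
by split; rewrite -(@ler_pXn2r _ 2)// ?nnegrE ?(ltW x0)// real_normK ?num_real// xE;
  [have := sqr_ge0 (x 2%:R 0)|have := sqr_ge0 (x 1 0)]; lra.
Qed.

(** A multiplicative triangle inequality through the origin. With its converse [mink_ge] it moves
    base points at the price of a constant factor. *)
Lemma mink_le p q : inH2 p -> inH2 q -> mink p q <= 2 * p 0 0 * q 0 0.
Proof.
move=> /inH2P[p0 pE] /inH2P[q0 qE]; rewrite minkE.
suff : - (p 1 0 * q 1 0 + p 2%:R 0 * q 2%:R 0) <= p 0 0 * q 0 0 by lra.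
apply: le_trans (ler_norm _) _.
rewrite -(@ler_pXn2r _ 2)// ?nnegrE ?mulr_ge0 ?(ltW p0) ?(ltW q0)//.
rewrite real_normK ?num_real// exprMn pE qE.
(* Lagrange's identity: this square is the defect in the Cauchy-Schwarz inequality for the spatial
   parts. *)
have := sqr_ge0 (p 1 0 * q 2%:R 0 - p 2%:R 0 * q 1 0).
have := sqr_ge0 (p 1 0); have := sqr_ge0 (p 2%:R 0).
have := sqr_ge0 (q 1 0); have := sqr_ge0 (q 2%:R 0).
nra.
Qed.

Lemma mink_ge p q : inH2 p -> inH2 q -> q 0 0 <= 2 * p 0 0 * mink p q.
Proof.
move=> /inH2P[p0 pE] /inH2P[q0 qE]; rewrite minkE.
set t := p 1 0 * q 1 0 + p 2%:R 0 * q 2%:R 0.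
suff : 2 * p 0 0 * t <= q 0 0 * (2 * p 0 0 ^+ 2 - 1) by rewrite /t; nra.
have p1 : 1 <= p 0 0 ^+ 2.
  by have := sqr_ge0 (p 1 0); have := sqr_ge0 (p 2%:R 0); lra.
apply: le_trans (ler_norm _) _.
rewrite -(@ler_pXn2r _ 2)// ?nnegrE ?mulr_ge0 ?(ltW p0) ?(ltW q0)//; try lra.
rewrite real_normK ?num_real// !exprMn.
have tt : t ^+ 2 <= (p 0 0 ^+ 2 - 1) * q 0 0 ^+ 2.
  rewrite pE qE /t.
  have := sqr_ge0 (p 1 0 * q 2%:R 0 - p 2%:R 0 * q 1 0).
  have := sqr_ge0 (p 1 0); have := sqr_ge0 (p 2%:R 0).
  have := sqr_ge0 (q 1 0); have := sqr_ge0 (q 2%:R 0).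
  nra.
have q2 := sqr_ge0 (q 0 0).
move: tt p1 q2; set P := p 0 0 ^+ 2; set Q := q 0 0 ^+ 2; set T := t ^+ 2 => *.
have : P * T <= P * ((P - 1) * Q) by rewrite ler_wpM2l//; lra.
nra.
Qed.

Lemma mink_gt0 p q : inH2 p -> inH2 q -> 0 < mink p q.
Proof.
move=> hp hq; have := mink_ge hp hq; have [p0 _] := inH2P hp.
have [q0 _] := inH2P hq => h.
by have := lt_le_trans q0 h; rewrite pmulr_rgt0// mulr_gt0.
Qed.

Lemma mink_ge1 p q : inH2 p -> inH2 q -> 1 <= mink p q.
Proof.
move=> hp hq; have m0 := mink_gt0 hp hq; move: m0.
have [p0 pE] := inH2P hp; have [q0 qE] := inH2P hq; rewrite minkE => m0.
set t := p 1 0 * q 1 0 + p 2%:R 0 * q 2%:R 0.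
suff : t <= p 0 0 * q 0 0 - 1 by rewrite /t; lra.
have p1 := inH2_ge1 hp; have q1 := inH2_ge1 hq.
apply: le_trans (ler_norm _) _.
have pq : 1 <= p 0 0 * q 0 0 by rewrite -[leLHS]mulr1 ler_pM.
rewrite -(@ler_pXn2r _ 2)// ?nnegrE ?subr_ge0//.
rewrite real_normK ?num_real//.
have tt : t ^+ 2 <= (p 0 0 ^+ 2 - 1) * (q 0 0 ^+ 2 - 1).
  rewrite pE qE /t.
  have := sqr_ge0 (p 1 0 * q 2%:R 0 - p 2%:R 0 * q 1 0).
  nra.
apply: le_trans tt _.
have := sqr_ge0 (p 0 0 - q 0 0).
nra.
Qed.

End Minkowski.

Definition polygon_cosh (R : realType) (n m : nat) : R :=
  cos (pi / m%:R) / sin (pi / n%:R).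

Section Reflections.
Variables (R : realType) (n m : nat).
Hypothesis C1 : 1 < polygon_cosh R n m.
Implicit Types (x y z p q : 'cV[R]_3) (i j : 'I_n) (w : seq 'I_n).

Local Notation C := (polygon_cosh R n m).
Local Notation v i := (@side_normal R n m i).
Definition polygon_sinh : R := Num.sqrt (C ^+ 2 - 1).
Local Notation s := polygon_sinh.
Definition side_angle i : R := 2 * pi * i%:R / n%:R.

Lemma polygon_sinhE : s ^+ 2 = C ^+ 2 - 1.
Proof. by rewrite sqr_sqrtr// subr_ge0 expr_ge1 ?ltW// (lt_trans _ C1). Qed.

Lemma polygon_sinh_gt0 : 0 < s.
Proof. by rewrite sqrtr_gt0 subr_gt0 expr_gt1// ltW// (lt_trans _ C1). Qed.

Lemma side_normal0 i : v i 0 0 = s.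
Proof. by rewrite mxE. Qed.

Lemma side_normal1 i : v i 1 0 = C * cos (side_angle i).
Proof. by rewrite mxE. Qed.

Lemma side_normal2 i : v i 2%:R 0 = C * sin (side_angle i).
Proof. by rewrite mxE. Qed.

Definition side_normalE := (side_normal0, side_normal1, side_normal2).

Lemma mink_side i j : mink (v i) (v j) = C ^+ 2 * (1 - cos (side_angle i - side_angle j)) - 1.
Proof.
rewrite minkE !side_normalE cosB; have := polygon_sinhE; rewrite expr2 => ->; ring.
Qed.

Lemma mink_side_id i : mink (v i) (v i) = -1.
Proof. by rewrite mink_side subrr cos0; ring. Qed.

Lemma gen_mul i x : gen n m i *m x = x + (2 * mink (v i) x) *: v i.
Proof. exact: refl_mul. Qed.

Lemma gen_mulE i x k : (gen n m i *m x) k 0 = x k 0 + 2 * mink (v i) x * v i k 0.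
Proof. by rewrite gen_mul mxE [X in _ + X = _]mxE. Qed.

Lemma genK i : gen n m i *m gen n m i = 1%:M :> 'M[R]_3.
Proof. exact/reflK/mink_side_id. Qed.

Lemma mink_gen i x y : mink (gen n m i *m x) (gen n m i *m y) = mink x y.
Proof. exact/mink_refl/mink_side_id. Qed.

Lemma gen_side i : gen n m i *m v i = - v i.
Proof.
by rewrite gen_mul mink_side_id mulrN1 -[X in X + _]scale1r -scalerDl (_ : 1 - 2 = -1 :> R) ?scaleN1r//; lra.
Qed.

(** The upper sheet is preserved because the height of [gen n m i *m x] is the product of [x] with
    the image of the origin, whose height is positive by computation. *)
Lemma gen_H2 i x : inH2 x -> inH2 (gen n m i *m x).
Proof.
move=> hx; have go : inH2 (gen n m i *m origin R).
  split; first by rewrite mink_gen; case: (origin_H2 R).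
  rewrite gen_mul mink_sym mink_origin !mxE/=.
  by have := sqr_ge0 s; rewrite -/s; lra.
split; first by rewrite mink_gen; case: hx.
by rewrite -mink_origin -(mink_gen i) mulmxA genK mul1mx mink_gt0.
Qed.

Lemma word_mat_H2 w x : inH2 x -> inH2 (word_mat n m w *m x).
Proof.
by elim: w x => [|i w IH] x hx /=; rewrite ?mul1mx// -mulmxA; apply/gen_H2/IH.
Qed.

Lemma mink_word w x y :
  mink (word_mat n m w *m x) (word_mat n m w *m y) = mink x y.
Proof. by elim: w => [|i w IH] /=; rewrite ?mul1mx// -!mulmxA mink_gen. Qed.

Lemma word_mat_rev w : word_mat n m (rev w) *m word_mat n m w = 1%:M :> 'M[R]_3.
Proof.
elim: w => [|i w IH]; first by rewrite mul1mx.
by rewrite rev_cons word_mat_rcons/= -mulmxA (mulmxA (gen _ _ _)) genK mul1mx.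
Qed.

Lemma det_word w : \det (word_mat n m w : 'M[R]_3) = (-1) ^+ size w.
Proof.
elim: w => [|i w IH]/=; first by rewrite det1.
by rewrite det_mulmx IH exprS [\det (gen _ _ _)](det_refl (mink_side_id i)).
Qed.

Lemma mink_word_origin w x :
  mink (word_mat n m w *m x) (origin R) = mink x (word_mat n m (rev w) *m origin R).
Proof. by rewrite -(mink_word (rev w)) mulmxA word_mat_rev mul1mx. Qed.

Lemma word_mat_ge1 w : 1 <= (word_mat n m w : 'M[R]_3) 0 0.
Proof. by rewrite -mulmx_origin; apply/inH2_ge1/word_mat_H2/origin_H2. Qed.

Lemma word_mat_rev00 w : (word_mat n m (rev w) : 'M[R]_3) 0 0 = (word_mat n m w : 'M[R]_3) 0 0.
Proof.
by rewrite -!mulmx_origin -(mink_origin (_ *m _)) -mink_word_origin mink_sym mink_origin.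
Qed.

Lemma word_mat_cat_le u w : (word_mat n m (u ++ w) : 'M[R]_3) 0 0 <=
  2 * (word_mat n m u : 'M[R]_3) 0 0 * (word_mat n m w : 'M[R]_3) 0 0.
Proof.
rewrite word_mat_cat -mulmx_origin -mulmxA -mink_origin mink_sym mink_word_origin.
rewrite (le_trans (mink_le _ _))//; [exact/word_mat_H2/origin_H2|exact/word_mat_H2/origin_H2|].
by rewrite !mulmx_origin word_mat_rev00 mulrAC.
Qed.

(** Together with [mink_orbit_ge], this makes displacements at [x] and at the origin agree up to an
    additive constant, so that neither growth nor drift depends on the base point. *)
Lemma mink_orbit_le x w : inH2 x ->
  mink x (word_mat n m w *m x) <= 4 * x 0 0 ^+ 2 * (word_mat n m w : 'M[R]_3) 0 0.
Proof.
move=> hx; have wx := word_mat_H2 w hx; have [x0 _] := inH2P hx.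
apply: le_trans (mink_le hx wx) _.
rewrite -(mink_origin (_ *m x)) mink_sym mink_word_origin.
have -> : 4 * x 0 0 ^+ 2 * (word_mat n m w : 'M[R]_3) 0 0 =
  2 * x 0 0 * (2 * x 0 0 * (word_mat n m (rev w) *m origin R) 0 0).
  by rewrite mulmx_origin word_mat_rev00; ring.
rewrite ler_wpM2l ?mulr_ge0 ?(ltW x0)//.
exact/mink_le/word_mat_H2/origin_H2.
Qed.

Lemma mink_orbit_ge x w : inH2 x ->
  (word_mat n m w : 'M[R]_3) 0 0 <= 4 * x 0 0 ^+ 2 * mink x (word_mat n m w *m x).
Proof.
move=> hx; have wx := word_mat_H2 w hx; have [x0 _] := inH2P hx.
have h1 := mink_ge hx wx.
have h2 := mink_ge hx (word_mat_H2 (rev w) (origin_H2 R)).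
rewrite -mink_word_origin mink_sym mink_origin mulmx_origin word_mat_rev00 in h2.
apply: le_trans h2 _.
have -> : 4 * x 0 0 ^+ 2 * mink x (word_mat n m w *m x) =
  2 * x 0 0 * (2 * x 0 0 * mink x (word_mat n m w *m x)) by ring.
by rewrite ler_wpM2l ?mulr_ge0 ?(ltW x0).
Qed.

End Reflections.

(** * Discreteness *)

(** Chebyshev polynomials of the second kind, shifted: [cheb g q] is [U_(q-1)] at [g]. They are the
    coefficients of the roots of a dihedral group whose two simple roots have product [g]. *)
Fixpoint cheb (R : pzRingType) (g : R) (q : nat) : R :=
  match q with
  | 0%N => 0
  | 1%N => 1
  | (q'.+1 as p).+1 => 2 * g * cheb g p - cheb g q'
  end.

Lemma chebSS (R : pzRingType) (g : R) q :
  cheb g q.+2 = 2 * g * cheb g q.+1 - cheb g q.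
Proof. by []. Qed.

Lemma cheb_cos (R : realType) (a : R) q : cheb (cos a) q * sin a = sin (q%:R * a).
Proof.
suff: cheb (cos a) q * sin a = sin (q%:R * a) /\
      cheb (cos a) q.+1 * sin a = sin (q.+1%:R * a) by case.
elim: q => [|q [IH1 IH2]]; first by rewrite /= !mul0r sin0 !mul1r.
split=> //; rewrite chebSS mulrBl IH1 -mulrA IH2.
rewrite -(natr1 q.+1) (mulrDl q.+1%:R) mul1r sinD.
have -> : q%:R * a = q.+1%:R * a - a by rewrite -natr1; ring.
by rewrite sinB; ring.
Qed.

Lemma cheb_ge0 (R : realDomainType) (g : R) q : 1 <= g -> 0 <= cheb g q.
Proof.
move=> g1; suff: 0 <= cheb g q <= cheb g q.+1 by case/andP.
elim: q => [|q /andP[IH1 IH2]]; first by rewrite /= lexx ler01.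
rewrite (le_trans IH1 IH2) andTb chebSS; move: (cheb g q) (cheb g q.+1) IH1 IH2 => x y.
move=> x0 xy; have : 0 <= (g - 1) * y by rewrite mulr_ge0//; lra.
nra.
Qed.

Section Alternating.
Variable T : Type.
Implicit Types s t : T.

Fixpoint altw s t q : seq T := if q is q'.+1 then s :: altw t s q' else [::].

Definition alt_next s t (q : nat) := if odd q then t else s.

Lemma size_altw s t q : size (altw s t q) = q.
Proof. by elim: q s t => //= q IH s t; rewrite IH. Qed.

Lemma altwS s t q : altw s t q.+1 = rcons (altw s t q) (alt_next s t q).
Proof.
elim: q s t => // q IH s t; rewrite [LHS]/= -/(altw t s q.+1) IH /=.
by rewrite /alt_next /=; case: odd.
Qed.

Lemma take_altw s t p q : (p <= q)%N -> take p (altw s t q) = altw s t p.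
Proof. by elim: q p s t => [|q IH] [|p] s t //= pq; rewrite IH. Qed.

End Alternating.

Lemma sin_sub_prod (R : realType) (x y : R) :
  sin x - sin y = 2 * (cos ((x + y) / 2) * sin ((x - y) / 2)).
Proof.
have {1}-> : x = (x + y) / 2 + (x - y) / 2 by lra.
have {3}-> : y = (x + y) / 2 - (x - y) / 2 by lra.
by rewrite sinD sinB; ring.
Qed.

Section Discreteness.
Variables (R : realType) (n m : nat).
Hypotheses (n3 : (3 < n)%N) (m3 : (3 < m)%N) (m_even : ~~ odd m).
Hypothesis C1 : 1 < polygon_cosh R n m.
Implicit Types (x y z : 'cV[R]_3) (i j s t : 'I_n) (w u : seq 'I_n) (q : nat).

Local Notation C := (polygon_cosh R n m).
Local Notation v i := (@side_normal R n m i).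
Local Notation word w := (word_mat n m w : 'M[R]_3).
Let phi : R := 2 * pi / m%:R.

Lemma sin_pin_gt0 : 0 < sin (pi / n%:R : R).
Proof.
have nR : 4 <= n%:R :> R by rewrite ler_nat.
have := pi_gt0 R => pg.
apply: sin_gt0_pi; apply/andP; split; first by rewrite divr_gt0//; lra.
by rewrite ltr_pdivrMr; nra.
Qed.

Lemma cos_sqr_ge_half (k : nat) : (3 < k)%N -> 1 / 2 <= cos (pi / k%:R : R) ^+ 2.
Proof.
move=> k3; have kR : 4 <= k%:R :> R by rewrite ler_nat.
have pg := pi_gt0 R.
have : 0 <= cos ((pi / k%:R : R) *+ 2).
  apply: cos_ge0_pihalf; rewrite -(mulr_natr (pi / k%:R)); apply/andP; split.
    apply: (@le_trans _ _ 0); first lra.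
    by rewrite mulr_ge0// divr_ge0; lra.
  by rewrite mulrAC ler_pdivrMr; nra.
by rewrite cos_mulr2n -[_ *+ 2]mulr_natr; lra.
Qed.

(** The Gram matrix of the polygon. With [d] half the angle between two normals, their product is
    [2 C^2 sin^2 d - 1]; the relation [C sin (pi / n) = cos (pi / m)] makes it [cos phi] for
    adjacent sides. The other sides lie on disjoint lines. *)
Lemma mink_side_neq i j : i != j ->
  mink (v i) (v j) = cos phi \/ 1 <= mink (v i) (v j).
Proof.
wlog ij : i j / (i < j)%N.
  move=> H; case: (ltngtP i j) => ij nij.
  - exact: H.
  - by rewrite mink_sym; apply: H => //; rewrite eq_sym.
  - by move: nij; rewrite -val_eqE/= ij eqxx.
move=> _; have nR : 4 <= n%:R :> R by rewrite ler_nat.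
have pg := pi_gt0 R; have sn := sin_pin_gt0.
pose d : R := (j - i)%:R * (pi / n%:R).
have dE : side_angle R i - side_angle R j = - (d *+ 2).
  rewrite /side_angle /d natrB 1?ltnW// -mulr_natr; ring.
have phiE : phi = (pi / m%:R) *+ 2 by rewrite /phi -mulr_natr; ring.
have mE : mink (v i) (v j) = 2 * C ^+ 2 * sin d ^+ 2 - 1.
  rewrite (mink_side C1) dE cosN cos_mulr2n cos2sin2 -mulr_natr; ring.
have Csin : C * sin (pi / n%:R) = cos (pi / m%:R).
  by rewrite /polygon_cosh divfK// gt_eqF.
have [dle|] := boolP ((j - i == 1) || (j - i == n.-1))%N.
  left; rewrite mE phiE cos_mulr2n -Csin.
  have -> : sin d = sin (pi / n%:R).
    case/orP: dle => /eqP dE1; rewrite /d dE1; first by rewrite mul1r.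
    have -> : n.-1%:R * (pi / n%:R) = pi - pi / n%:R :> R.
      have -> : n.-1%:R = n%:R - 1 :> R by rewrite -subn1 natrB//; lia.
      by field; lra.
    by rewrite sinB sinpi cospi; ring.
  rewrite -mulr_natr; ring.
rewrite negb_or => /andP[/eqP d1 /eqP dn1]; right.
have d2 : (2 <= j - i)%N by lia.
have dn2 : (j - i <= n - 2)%N by have := ltn_ord j; lia.
have sd : sin ((pi / n%:R) *+ 2) <= sin d.
  have h1 : pi / n%:R *+ 2 <= d.
    by rewrite /d -mulr_natl ler_wpM2r ?ler_nat// divr_ge0//; lra.
  have h2 : d <= pi - pi / n%:R *+ 2.
    have -> : pi - pi / n%:R *+ 2 = (n - 2)%:R * (pi / n%:R) :> R.
      rewrite natrB; last lia.
      by rewrite -mulr_natr; field; lra.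
    by rewrite /d ler_wpM2r ?ler_nat// divr_ge0//; lra.
  rewrite -subr_ge0.
  rewrite sin_sub_prod.
  have pn : 0 < pi / n%:R :> R by rewrite divr_gt0//; lra.
  rewrite !mulr_ge0//.
    by apply: cos_ge0_pihalf; apply/andP; split; lra.
  by apply: sin_ge0_pi; apply/andP; split; lra.
have s2 : 0 <= sin ((pi / n%:R) *+ 2) :> R.
  rewrite sin_mulr2n mulrn_wge0// mulr_ge0// ?(ltW sn)//.
  apply: cos_ge0_pihalf; apply/andP; split.
    apply: (@le_trans _ _ 0); first lra.
    by rewrite divr_ge0//; lra.
  by rewrite ler_pdivrMr; nra.
have sd2 : sin ((pi / n%:R) *+ 2) ^+ 2 <= sin d ^+ 2.
  by rewrite ler_pXn2r// nnegrE (le_trans s2).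
rewrite mE lerBrDr.
apply: (@le_trans _ _ (2 * C ^+ 2 * sin (pi / n%:R *+ 2) ^+ 2)); last first.
  by rewrite ler_wpM2l// mulr_ge0// sqr_ge0.
have -> : 2 * C ^+ 2 * sin (pi / n%:R *+ 2) ^+ 2 =
   8 * (cos (pi / m%:R) ^+ 2 * cos (pi / n%:R) ^+ 2) :> R.
  rewrite -Csin sin_mulr2n -mulr_natr; ring.
(* Both squared cosines are at least [1 / 2], since [m] and [n] are at least 4; this gives
   [8 / 4 - 1 = 1]. *)
have h1 := cos_sqr_ge_half m3; have h2 := cos_sqr_ge_half n3.
have : (1 / 2) * (1 / 2) <= cos (pi / m%:R) ^+ 2 * cos (pi / n%:R) ^+ 2 :> R.
  by rewrite ler_pM//; lra.
lra.
Qed.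

Lemma word_altw q s t :
  word (altw s t q) *m v (alt_next s t q) =
  cheb (mink (v s) (v t)) q.+1 *: v s + cheb (mink (v s) (v t)) q *: v t.
Proof.
elim: q s t => [|q IH] s t; first by rewrite mul1mx scale1r scale0r addr0.
have -> : alt_next s t q.+1 = alt_next t s q by rewrite /alt_next/=; case: odd.
have -> : word (altw s t q.+1) = gen n m s *m word (altw t s q) by [].
rewrite -mulmxA IH mulmxDr -!scalemxAr (gen_side C1) gen_mul (mink_sym (v t)).
rewrite chebSS scalerDr scalerN scalerA -addrA addrC; congr (_ + _).
rewrite -scaleNr -scalerDl; congr (_ *: _); ring.
Qed.

Let K := m./2.
Let mK : m = (K + K)%N.
Proof. by rewrite addnn -[LHS]odd_double_half (negPf m_even). Qed.

Let phiK : K%:R * phi = pi.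
Proof.
have mR : 4 <= m%:R :> R by rewrite ler_nat.
rewrite /phi; have -> : m%:R = K%:R + K%:R :> R by rewrite -natrD -mK.
have : K%:R + K%:R = m%:R :> R by rewrite -natrD -mK.
move=> KE; field; lra.
Qed.

Let sinphi : 0 < sin phi.
Proof.
have mR : 4 <= m%:R :> R by rewrite ler_nat.
have pg := pi_gt0 R.
apply: sin_gt0_pi; rewrite /phi; apply/andP; split; first by rewrite divr_gt0//; lra.
by rewrite ltr_pdivrMr; nra.
Qed.

(** The Coxeter relation. The Chebyshev values at [K + K] show that both roots are fixed, since
    [(K + K) phi = 2 pi]; their orthogonal complement is fixed by each reflection. *)
Lemma word_altw_order s t : mink (v s) (v t) = cos phi ->
  word (altw s t (K + K)) = 1%:M.
Proof.
move=> g; set M := word _; have sn0 : sin phi != 0 by rewrite gt_eqF.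
have K0 : (0 < K)%N by move: m3 mK; lia.
have ch q a : sin (q%:R * phi) = a * sin phi -> cheb (cos phi) q = a.
  by move=> h; apply: (mulIf sn0); rewrite cheb_cos.
have KK : (K + K)%:R * phi = pi *+ 2 by rewrite natrD mulrDl phiK mulr2n.
have Ms : M *m v s = v s.
  have := word_altw (K + K) s t; rewrite /alt_next oddD addbb g.
  rewrite (ch (K + K)%N 0); last by rewrite KK sin2pi mul0r.
  rewrite (ch (K + K).+1 1) ?scale1r ?scale0r ?addr0//.
  by rewrite -natr1 mulrDl KK mul1r addrC sinD2pi mul1r.
have Mt : M *m v t = v t.
  have KS : (K + K = (K + K).-1.+1)%N by lia.
  have oKK : odd (K + K).-1 by have := oddD K K; rewrite addbb {1}KS /= => /negbFE.
  have ME : M = word (altw s t (K + K).-1) *m gen n m t.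
    by rewrite /M {1}KS altwS /alt_next oKK word_mat_rcons.
  have := word_altw (K + K).-1 s t; rewrite /alt_next oKK g -KS => E.
  rewrite ME -mulmxA (gen_side C1) mulmxN E.
  rewrite (ch (K + K)%N 0); last by rewrite KK sin2pi mul0r.
  rewrite (ch (K + K).-1 (-1)) ?scaleN1r ?scale0r ?add0r ?opprK//.
  have -> : (K + K).-1%:R * phi = - phi + pi *+ 2.
    by rewrite -KK [in RHS]KS -natr1; ring.
  by rewrite sinD2pi sinN mulN1r.
apply: mulmx_ext => x; rewrite mul1mx.
pose a := mink (v s) x; pose b := mink (v t) x.
(* [al] and [be] solve the Gram system of the two roots, of determinant [sin phi ^+ 2], so that the
   remainder [z] is orthogonal to both. *)
pose al := - (a + cos phi * b) / sin phi ^+ 2.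
pose be := - (b + cos phi * a) / sin phi ^+ 2.
pose z := x + (- al) *: v s + (- be) *: v t.
have zs : mink (v s) z = 0.
  rewrite /z !minkDr !minkZr g (mink_side_id C1) -/a /al /be.
  by rewrite sin2cos2; field; rewrite -sin2cos2 expf_neq0.
have zt : mink (v t) z = 0.
  rewrite /z !minkDr !minkZr (mink_sym (v t) (v s)) g (mink_side_id C1) -/b /al /be.
  by rewrite sin2cos2; field; rewrite -sin2cos2 expf_neq0.
have fixz q : (word (altw s t q) *m z = z) * (word (altw t s q) *m z = z).
  elim: q => [|q [IH1 IH2]]; first by rewrite mul1mx.
  by split; rewrite /= -mulmxA ?IH1 ?IH2 gen_mul ?zs ?zt mulr0 scale0r addr0.
have zE : x = al *: v s + be *: v t + z.
  by rewrite /z !scaleNr [RHS]addrC [al *: _ + _]addrC addrA !subrK.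
clearbody z; rewrite zE.
by rewrite !mulmxDr -!scalemxAr Ms Mt (fixz (K + K)%N).1.
Qed.

(** Reduced expressions in the sense of Coxeter groups, with length measured in the matrix group;
    stronger than the free reducedness of [reduced]. *)
Definition short w := forall w', word w' = word w -> (size w <= size w')%N.

Lemma short_infix w u w' : short (w ++ u ++ w') -> short u.
Proof.
move=> h u' uu'; have := h (w ++ u' ++ w').
by rewrite !word_mat_cat uu' !size_cat => /(_ erefl); lia.
Qed.

Lemma short_exists w : exists2 w', word w' = word w & short w'.
Proof.
have [k] := ubnP (size w); elim: k w => // k IH w /ltnSE hk.
have [sw|] := pselect (short w); first by exists w.
move=> /existsNP[w' /not_implyP[ww' /negP]]; rewrite -ltnNge => lt.
by have [w2 h1 h2] := IH w' (leq_trans lt hk); exists w2; rewrite // h1.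
Qed.

Lemma short_rev w : short w -> short (rev w).
Proof.
move=> h w' E; rewrite size_rev -(size_rev w'); apply: h.
rewrite -[LHS]mulmx1 -(word_mat_rev C1 w) mulmxA -E word_mat_rev//.
by rewrite mul1mx.
Qed.

Lemma short_altw s t u : all (mem [:: s; t]) u -> short (rcons u s) ->
  rcons u s = altw s t (size u).+1 \/ rcons u s = altw t s (size u).+1.
Proof.
elim: u => [|x u IH]; first by left.
move=> /= /andP[xst ust] hs.
have cancel a w : rcons u s = a :: w -> x != a.
  move=> E; apply/eqP => xa; have := hs w.
  rewrite E xa /= mulmxA (genK C1) mul1mx => /(_ erefl).
  by rewrite ltnNge leqnSn.
have su : short (rcons u s).
  by apply: (@short_infix [:: x] _ [::]); rewrite cats0.
case: (IH ust su) => E.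
- right; rewrite E; move: xst; rewrite !inE (negPf (cancel _ _ E)) /=.
  by move=> /eqP ->.
- left; rewrite E; move: xst; rewrite !inE (negPf (cancel _ _ E)) orbF.
  by move=> /eqP ->.
Qed.

(** Cutting the relator of length [K + K] after [K + 1] letters shows that an alternating word of
    [K + 1] letters equals a word of [K - 1] letters. *)
Lemma short_altw_le s t q : mink (v s) (v t) = cos phi -> short (altw s t q) -> (q <= K)%N.
Proof.
move=> g h; rewrite leqNgt; apply/negP => Kq.
have K0 : (0 < K)%N by move: m3 mK; lia.
have hK : short (altw s t K.+1).
  by apply: (@short_infix [::] _ (drop K.+1 (altw s t q))); rewrite cat0s -(take_altw s t Kq) cat_take_drop.
pose r := drop K.+1 (altw s t (K + K)).
have := hK (rev r); rewrite size_altw size_rev size_drop size_altw.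
have -> : word (rev r) = word (altw s t K.+1).
  have : word (altw s t (K + K)) = 1%:M by apply: word_altw_order.
  rewrite -(cat_take_drop K.+1 (altw s t (K + K))) take_altw; last lia.
  rewrite word_mat_cat -/r => E.
  by rewrite -[RHS]mulmx1 -(word_mat_rev C1 (rev r)) revK mulmxA E mul1mx.
by move=> /(_ erefl); lia.
Qed.

(* As in Humphreys, Reflection Groups and Coxeter Groups, Theorem 5.4: write the element as [p u]
   with [u] in the dihedral group generated by [s] and the last letter of [w], and [p] of minimal
   length; then [p] sends both simple roots of that dihedral group to positive roots. *)
Lemma root_nonneg w s : short (rcons w s) -> 0 <= (word w *m v s) 0 0.
Proof.
have [N] := ubnP (size w); elim: N w s => // N IH w s /ltnSE hN hs.
case/lastP: w hN hs => [|w0 t] hN hs.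
  by rewrite mul1mx side_normal0 (ltW (polygon_sinh_gt0 C1)).
have st : s != t.
  apply/eqP => E; have := hs w0; rewrite E !word_mat_rcons -mulmxA (genK C1) mulmx1.
  by rewrite !size_rcons => /(_ erefl); lia.
pose Q d := exists v u, [/\ size v = d, word (v ++ u) = word (rcons w0 t),
  (size v + size u <= size (rcons w0 t))%N & all (mem [:: s; t]) u].
have exQ : exists d, `[< Q d >].
  exists (size w0); apply/asboolP; exists w0, [:: t]; split => //.
  - by rewrite cats1.
  - by rewrite size_rcons /= addn1.
  - by rewrite /= !inE eqxx orbT.
case: (ex_minnP exQ) => d /asboolP[p [u [pd pu pus ust]]] dmin.
(* Splitting off the last letter [t] is one admissible factorisation, so the minimal prefix [p] is
   shorter than the word and the induction applies to it. *)
have dw0 : (d <= size w0)%N.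
  apply: dmin; apply/asboolP; exists w0, [:: t]; split => //.
  - by rewrite cats1.
  - by rewrite size_rcons /= addn1.
  - by rewrite /= !inE eqxx orbT.
have spu : short (p ++ rcons u s).
  move=> w' Ew'; have := hs w'; rewrite Ew' -rcons_cat !(@word_mat_rcons _ _ _ _ s) pu => /(_ erefl).
  by move: pus; rewrite !size_rcons !size_cat; lia.
have sp r : r \in [:: s; t] -> short (rcons p r).
  move=> rst w' Ew'; rewrite leqNgt; apply/negP => lt.
  (* Equality of lengths is excluded by the determinants. A word shorter than [p] would let [r] move
     into [u], against the minimality of [d]. *)
  have lt2 : (size w' < size p)%N.
    rewrite ltn_neqAle; apply/andP; split; last by move: lt; rewrite size_rcons; lia.
    apply/eqP => E; have /(congr1 determinant) := Ew'.
    rewrite !(det_word C1) E size_rcons exprS => /eqP.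
    rewrite -subr_eq0 -[X in X - _]mul1r -mulrBl mulf_eq0 signr_eq0 orbF opprK.
    by rewrite -[1 + 1]/(2%:R) pnatr_eq0.
  suff: (d <= size w')%N by rewrite leqNgt -pd lt2.
  apply: dmin; apply/asboolP; exists w', (r :: u); split => //.
  - rewrite -pu !word_mat_cat Ew' word_mat_rcons /= -mulmxA.
    by rewrite (mulmxA (gen _ _ _)) (genK C1) mul1mx.
  - by move: pus; rewrite /=; lia.
  - by rewrite /= ust andbT.
have pos r : r \in [:: s; t] -> 0 <= (word p *m v r) 0 0.
  by move=> rst; apply: IH (sp _ rst); move: hN; rewrite size_rcons pd; lia.
have su : short (rcons u s).
  by apply: (@short_infix p _ [::]); rewrite cats0.
have key a b : a \in [:: s; t] -> b \in [:: s; t] -> a != b ->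
    rcons u s = altw a b (size u).+1 -> 0 <= (word (rcons w0 t) *m v s) 0 0.
  move=> ast bst ab E; move: (E); rewrite altwS => /rcons_inj[Eu Es].
  rewrite -pu word_mat_cat -mulmxA Eu Es word_altw mulmxDr -!scalemxAr.
  move: (pos a ast) (pos b bst); move: (word p *m v a) (word p *m v b) => x y x0 y0.
  rewrite !mxE.
  rewrite E in su.
  (* For disjoint sides all Chebyshev coefficients are nonnegative. For adjacent ones, shortness
     bounds the index by [K], which keeps the angle [q phi] in [[0, pi]]. *)
  have [g|g] := mink_side_neq ab; last first.
    by apply: addr_ge0; apply: mulr_ge0; rewrite ?cheb_ge0.
  have cg q : (q <= K)%N -> 0 <= cheb (mink (v a) (v b)) q.
    move=> qK; rewrite g -(pmulr_lge0 _ sinphi) cheb_cos.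
    apply: sin_ge0_pi; rewrite mulr_ge0 ?divr_ge0//=; last by rewrite mulr_ge0// pi_ge0.
    by rewrite -phiK ler_wpM2r ?ler_nat// divr_ge0// mulr_ge0// pi_ge0.
  have uK := short_altw_le g su.
  by apply: addr_ge0; apply: mulr_ge0; rewrite ?cg// ltnW.
case: (short_altw ust su); apply: key; rewrite ?inE ?eqxx ?orbT// eq_sym//.
Qed.

(** If a shortest word begins with [i], positivity of the root of the reversed tail puts the image
    of the origin beyond the line of side [i], hence at distance at least the inradius. *)
Lemma word_mat_sep w : word w != 1%:M -> C <= word w 0 0.
Proof.
move=> w1; have [w' E sw] := short_exists w; rewrite -E in w1 *.
have C0 : 0 < C by apply: lt_trans C1.
case: w' {E} sw w1 => [|i u] sw; first by rewrite eqxx.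
move=> _; have := short_rev sw; rewrite rev_cons => /root_nonneg h.
set z := word (i :: u) *m origin R.
have zE : mink (v i) z <= 0.
  rewrite /z /= -mulmxA -(mink_gen C1 i) mulmxA (genK C1) mul1mx (gen_side C1).
  rewrite -scaleN1r minkZl mulN1r oppr_le0 -{1}(revK u) -(mink_word_origin C1).
  by rewrite mink_sym mink_origin.
have [z0 zz] := inH2P (word_mat_H2 C1 (i :: u) (origin_H2 R)); rewrite -/z in z0 zz.
rewrite -mulmx_origin -/z -(@ler_pXn2r _ 2)// ?nnegrE ?(ltW C0) ?(ltW z0)//.
have sE := polygon_sinhE C1; have s0 := polygon_sinh_gt0 C1.
move: zE; rewrite minkE !side_normalE.
set c := cos _; set d := sin _.
have cd : c ^+ 2 + d ^+ 2 = 1 by rewrite cos2Dsin2.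
move=> zE.
have {}zE : polygon_sinh R n m * z 0 0 <= C * (c * z 1 0 + d * z 2%:R 0) by lra.
set L := c * z 1 0 + d * z 2%:R 0 in zE.
have LL : L ^+ 2 <= z 0 0 ^+ 2 - 1.
  have := sqr_ge0 (d * z 1 0 - c * z 2%:R 0).
  have -> : z 0 0 ^+ 2 - 1 = (c ^+ 2 + d ^+ 2) * (z 1 0 ^+ 2 + z 2%:R 0 ^+ 2).
    by rewrite cd zz; ring.
  by rewrite /L; nra.
have : (polygon_sinh R n m * z 0 0) ^+ 2 <= (C * L) ^+ 2.
  by rewrite ler_pXn2r// nnegrE ?(le_trans _ zE)// mulr_ge0// ltW.
rewrite (exprMn _ (polygon_sinh R n m)) (exprMn _ C) sE; have C2 := sqr_ge0 C.
have : C ^+ 2 * L ^+ 2 <= C ^+ 2 * (z 0 0 ^+ 2 - 1) by rewrite ler_wpM2l.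
lra.
Qed.

Lemma orbit_sep u w : word u != word w ->
  C <= mink (word u *m origin R) (word w *m origin R).
Proof.
move=> uw; rewrite mink_sym -{1}(revK w) mink_sym -[u]revK.
rewrite mink_sym -(mink_word C1 (rev (rev (rev u)))) !revK.
rewrite (mulmxA _ (word u)) word_mat_rev// mul1mx mink_sym.
rewrite mulmxA -word_mat_cat mink_origin mulmx_origin; apply: word_mat_sep.
apply: contra uw => /eqP E; rewrite -[word u]mulmx1 -E word_mat_cat mulmxA.
by rewrite -{1}(revK u) word_mat_rev// mul1mx.
Qed.

End Discreteness.

(** * Volume growth *)

(** Finiteness belongs to the conclusion because [fset_set] is empty on infinite sets, where its
    cardinal says nothing. *)
Lemma card_fset_set_le (T : choiceType) (A : set T) (N : nat) (f : T -> nat) :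
  (forall x, A x -> (f x < N)%N) ->
  (forall x y, A x -> A y -> f x = f y -> x = y) ->
  finite_set A /\ (#|` fset_set A| <= N)%N.
Proof.
move=> fN finj.
have AN : (A #<= `I_N)%card.
  have fA : (f @` A #= A)%card.
    by apply: inj_card_eq => x y /set_mem Ax /set_mem Ay; exact: finj.
  rewrite -(card_le_eql fA); apply: subset_card_le => _ [x Ax <-].
  exact: fN.
split; last exact: geq_card_fset_set.
by apply: card_le_finite AN _; exact: finite_II.
Qed.

Lemma card_fset_set_ge (T : choiceType) (A : set T) (N : nat) (f : nat -> T) :
  finite_set A -> (forall i, (i < N)%N -> A (f i)) ->
  (forall i j, (i < j)%N -> (j < N)%N -> f i <> f j) ->
  (N <= #|` fset_set A|)%N.
Proof.
move=> finA fA finj; apply: leq_card_fset_set => //.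
have fI : (f @` `I_N #= `I_N)%card.
  apply: inj_card_eq => i j /set_mem /= iN /set_mem /= jN E.
  by case: (ltngtP i j) => // h; [have := finj _ _ h jN|have := finj _ _ h iN]; rewrite E.
rewrite -(card_le_eql fI); apply: subset_card_le => _ [i iN <-].
exact: fA.
Qed.

Lemma polar_coordinates (R : realType) (a b : R) :
  exists2 t, 0 <= t <= 2 * pi &
    a = Num.sqrt (a ^+ 2 + b ^+ 2) * cos t /\ b = Num.sqrt (a ^+ 2 + b ^+ 2) * sin t.
Proof.
set r := Num.sqrt _; have pi0 := pi_gt0 R.
have r0 : 0 <= r by rewrite sqrtr_ge0.
have rE : r ^+ 2 = a ^+ 2 + b ^+ 2 by rewrite sqr_sqrtr// addr_ge0 ?sqr_ge0.
have [r00|rn0] := eqVneq r 0.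
  exists 0; first by apply/andP; split; lra.
  have a2 := sqr_ge0 a; have b2 := sqr_ge0 b.
  have a0 : a ^+ 2 = 0 by move: rE; rewrite r00; lra.
  have b0 : b ^+ 2 = 0 by move: rE; rewrite r00; lra.
  move: a0 b0 => /eqP; rewrite sqrf_eq0 => /eqP -> /eqP; rewrite sqrf_eq0 => /eqP ->.
  by rewrite r00 !mul0r.
have rp : 0 < r by rewrite lt_neqAle eq_sym rn0.
have ar : -1 <= a / r <= 1.
  rewrite -ler_norml normf_div (gtr0_norm rp) ler_pdivrMr// mul1r.
  rewrite -(@ler_pXn2r _ 2)// ?nnegrE// real_normK ?num_real// rE lerDl.
  exact: sqr_ge0.
have ca : cos (acos (a / r)) = a / r by rewrite acosK// in_itv.
have sa : r * sin (acos (a / r)) = `|b|.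
  have s1 : 0 <= 1 - (a / r) ^+ 2 by case/andP: ar; nra.
  have rs0 : 0 <= r * Num.sqrt (1 - (a / r) ^+ 2) by rewrite mulr_ge0 ?sqrtr_ge0.
  rewrite sin_acos//; apply/eqP; rewrite -(@eqrXn2 _ 2)//; apply/eqP.
  rewrite exprMn (sqr_sqrtr s1) real_normK ?num_real//.
  have -> : r ^+ 2 * (1 - (a / r) ^+ 2) = r ^+ 2 - a ^+ 2 by field.
  by rewrite rE; ring.
have a0 := acos_ge0 ar; have ap := acos_lepi ar.
have [b0|b0] := leP 0 b.
  exists (acos (a / r)); first by apply/andP; split; lra.
  by rewrite ca sa ger0_norm// mulrC divfK.
exists (2 * pi - acos (a / r)); first by apply/andP; split; lra.
have e2 : 2 * pi = pi *+ 2 :> R by rewrite mulr_natl.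
rewrite e2 cosB sinB cos2pi sin2pi mul1r !mul0r addr0 sub0r mul1r mulrN sa ca.
by rewrite ltr0_norm// opprK mulrC divfK.
Qed.

Lemma ler_cos_norm (R : realType) (x y : R) : `|x| <= y -> y <= pi -> cos y <= cos x.
Proof.
move=> xy ypi; rewrite -(cos_norm x) leNgt; apply/negP => h.
have x0 := normr_ge0 x.
by move: h; rewrite ltr_cos ?in_itv/= ?x0 ?(le_trans xy)// ?(le_trans x0)// ltNge xy.
Qed.

Section Growth.
Variables (R : realType) (n m : nat).
Hypotheses (n3 : (3 < n)%N) (m3 : (3 < m)%N) (m_even : ~~ odd m).
Hypothesis C1 : 1 < polygon_cosh R n m.
Implicit Types (x y z p q : 'cV[R]_3) (i j : 'I_n) (w u : seq 'I_n).

Local Notation C := (polygon_cosh R n m).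
Local Notation v i := (@side_normal R n m i).
Local Notation s := (polygon_sinh R n m).
Local Notation word w := (word_mat n m w : 'M[R]_3).

Lemma nearest_side (a b : R) : exists i : 'I_n,
  cos (pi / n%:R) * Num.sqrt (a ^+ 2 + b ^+ 2) <=
  a * cos (side_angle R i) + b * sin (side_angle R i).
Proof.
have [t /andP[t0 t2] [aE bE]] := polar_coordinates a b.
have nR : 4 <= n%:R :> R by rewrite ler_nat.
have pg := pi_gt0 R.
set r := Num.sqrt _ in aE bE *; have r0 : 0 <= r by rewrite sqrtr_ge0.
(* The integer nearest to [t n / (2 pi)], that is, the side whose direction is closest to [t]. *)
pose k := Num.truncn (t * n%:R / (2 * pi) + 1 / 2).
have y0 : 0 <= t * n%:R / (2 * pi) + 1 / 2.
  by rewrite addr_ge0// divr_ge0// mulr_ge0//; lra.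
have /andP[k1 k2] := truncn_itv y0; rewrite -/k -(natr1 k) in k1 k2.
have kt : `|t - 2 * pi * k%:R / n%:R| <= pi / n%:R.
  have -> : t - 2 * pi * k%:R / n%:R = (t * n%:R / (2 * pi) - k%:R) * (2 * pi / n%:R).
    by field; apply/andP; split; lra.
  rewrite normrM (ger0_norm (x := 2 * pi / n%:R)); last by rewrite divr_ge0//; lra.
  have -> : pi / n%:R = (1 / 2) * (2 * pi / n%:R) :> R by field; lra.
  rewrite ler_wpM2r//; first by rewrite divr_ge0//; lra.
  rewrite ler_norml; apply/andP; split; lra.
have key t' : `|t - t'| <= pi / n%:R -> cos (pi / n%:R) * r <= a * cos t' + b * sin t'.
  move=> h; have -> : a * cos t' + b * sin t' = cos (t - t') * r.
    by rewrite {1}aE {1}bE cosB; ring.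
  by rewrite ler_wpM2r// ler_cos_norm// ler_pdivrMr; nra.
have kn : (k <= n)%N.
  rewrite -ltnS -(ltr_nat R) -natr1; apply: le_lt_trans k1 _.
  have : t * n%:R / (2 * pi) <= n%:R.
    by rewrite ler_pdivrMr; nra.
  lra.
(* The value [k = n] stands for side 0, seen at the angle [2 pi]. *)
move: kn; rewrite leq_eqVlt => /orP[/eqP kn|kn]; last first.
  by exists (Ordinal kn); apply: key.
have n0 : (0 < n)%N by exact: leq_trans n3.
exists (Ordinal n0); have := key (pi *+ 2).
rewrite /side_angle /= mulr0 mul0r cos0 sin0 cos2pi sin2pi; apply.
move: kt; rewrite kn; congr (`|t - _| <= _); rewrite -mulr_natl; field; lra.
Qed.

(* A point of its orbit whose height is almost minimal lies almost inside the polygon, so the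
   discreteness of the orbit is not needed here. *)
Lemma cocompact : exists2 D : R, 1 <= D &
  forall p, inH2 p -> exists w, (word w *m p) 0 0 <= D.
Proof.
have s0 := polygon_sinh_gt0 C1; have sE := polygon_sinhE C1.
have C0 : 0 < C by apply: lt_trans C1.
have sn := @sin_pin_gt0 R n n3.
have nR : 4 <= n%:R :> R by rewrite ler_nat.
have mR : 4 <= m%:R :> R by rewrite ler_nat.
have pg := pi_gt0 R.
have cn0 : 0 < cos (pi / n%:R : R).
  apply: cos_gt0_pihalf; apply/andP; split.
    apply: (@lt_le_trans _ _ 0); first lra.
    by rewrite divr_ge0//; lra.
  by rewrite ltr_pdivrMr; nra.
(* The vertices lie in the plane and not at infinity; squared, this is [cos (pi / m) ^+ 2 < 1]. *)
have gap : s < C * cos (pi / n%:R).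
  have Cc0 : 0 <= C * cos (pi / n%:R) by apply: mulr_ge0; exact: ltW.
  rewrite -(@ltr_pXn2r _ 2)// ?nnegrE ?(ltW s0)//.
  rewrite (exprMn _ C) sE cos2sin2.
  have -> : C ^+ 2 * (1 - sin (pi / n%:R) ^+ 2) = C ^+ 2 - cos (pi / m%:R) ^+ 2.
    have <- : C * sin (pi / n%:R) = cos (pi / m%:R) by rewrite /polygon_cosh divfK// gt_eqF.
    by ring.
  rewrite ltrD2l ltrN2 cos2sin2 ltrBlDr ltrDl exprn_gt0//.
  exact: sin_pin_gt0.
set c := cos (pi / n%:R) in cn0 gap.
(* The solution [z0] of [s z0 - C c (z0 - 1) = -1], the extreme case of the inequalities below. *)
exists ((1 + C * c) / (C * c - s)).
  by rewrite ler_pdivlMr; lra.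
move=> p hp.
pose E := [set (word w *m p) 0 0 | w in [set: seq 'I_n]].
have lbE : has_lbound E.
  by exists 1 => _ [w _ <-]; apply/inH2_ge1/word_mat_H2.
have infE : has_inf E by split => //; exists ((word [::] *m p) 0 0), [::].
(* Reflecting [z] in side [i] changes its height by [2 s] times its product with the normal, so this
   slack keeps the product above [-1]. *)
have e0 : 0 < 2 * s by rewrite mulr_gt0.
have [_ [w _ <-] hw] := inf_adherent e0 infE.
exists w; set z := word w *m p in hw *.
have hz : inH2 z by apply: word_mat_H2.
have [z0 zz] := inH2P hz.
have [i hi] := nearest_side (z 1 0) (z 2%:R 0).
have side_i : -1 <= mink (v i) z.
  have : inf E <= (gen n m i *m z) 0 0.
    by apply: ge_inf => //; exists (i :: w) => //=; rewrite -mulmxA.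
  rewrite gen_mulE side_normal0.
  move: (mink _ _) => b hb; rewrite -subr_ge0.
  by rewrite -(pmulr_rge0 _ e0); lra.
set r := Num.sqrt _ in hi.
have rz : z 0 0 - 1 <= r.
  have z1 := inH2_ge1 hz.
  rewrite -(@ler_pXn2r _ 2)// ?nnegrE ?subr_ge0// ?sqrtr_ge0//.
  rewrite sqr_sqrtr ?addr_ge0 ?sqr_ge0//; nra.
rewrite ler_pdivlMr ?subr_gt0//.
move: side_i; rewrite minkE !side_normalE => side_i.
have h1 : C * (c * r) <= C * (z 1 0 * cos (side_angle R i) + z 2%:R 0 * sin (side_angle R i)).
  by rewrite ler_wpM2l// ltW.
have h2 : C * c * (z 0 0 - 1) <= C * c * r.
  by rewrite ler_wpM2l// mulr_ge0// ltW.
lra.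
Qed.

(** [N] points are spread over one radian of a circle of hyperbolic sine [S]. Each is brought back
    to height at most [D]; the same element cannot bring back two of them, as they are too far
    apart. *)
Lemma orbit_count_ge : exists2 D : R, 1 <= D & forall (S : R) (N : nat),
  0 < S -> N%:R <= S / (3 * D) -> exists f : nat -> 'M[R]_3,
    (forall k, Gamma n m (f k)) /\
    (forall k, (f k) 0 0 <= 2 * D * (1 + S)) /\
    (forall k l, (k < l)%N -> (l < N)%N -> f k <> f l).
Proof.
have [D D1 HD] := cocompact; exists D => // S N S0 NS.
pose a (i : nat) : R := i%:R / N%:R.
pose p (i : nat) : 'cV[R]_3 := \col_k (if k == 0 then Num.sqrt (1 + S ^+ 2)
  else if k == 1 then S * cos (a i) else S * sin (a i)).
have S2 : Num.sqrt (1 + S ^+ 2) ^+ 2 = 1 + S ^+ 2 by rewrite sqr_sqrtr// addr_ge0 ?sqr_ge0.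
have pp (i j : nat) : mink (p i) (p j) = 1 + S ^+ 2 * (1 - cos (a j - a i)).
  rewrite minkE !mxE /= cosB -expr2 S2; ring.
have hp (i : nat) : inH2 (p i).
  split; first by rewrite pp subrr cos0; ring.
  by rewrite mxE/= sqrtr_gt0; have := sqr_ge0 S; lra.
have p0E (i : nat) : p i 0 0 = Num.sqrt (1 + S ^+ 2) by rewrite mxE.
have [w Hw] := choice (fun i : nat => HD (p i) (hp i)).
have q0 (k : nat) := ltW (inH2P (word_mat_H2 C1 (w k) (hp k))).1.
exists (fun i : nat => word (w i)); split; first by move=> i; exists (w i).
split.
  move=> i; rewrite -mulmx_origin.
  apply: le_trans (mink_ge (word_mat_H2 C1 (w i) (hp i)) (word_mat_H2 C1 (w i) (origin_H2 R))) _.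
  rewrite (mink_word C1) mink_sym mink_origin p0E.
  apply: ler_pM; [by apply: mulr_ge0; rewrite ?q0|exact: sqrtr_ge0|by rewrite ler_wpM2l ?Hw|].
  rewrite -(@ler_pXn2r _ 2)// ?nnegrE ?sqrtr_ge0//; last lra.
  by rewrite S2; nra.
move=> i j ij jN E.
have := mink_le (word_mat_H2 C1 (w i) (hp i)) (word_mat_H2 C1 (w i) (hp j)).
rewrite (mink_word C1) pp {2}E leNgt => /negP; apply.
have N0 : 0 < N%:R :> R by rewrite ltr0n (leq_ltn_trans _ jN).
have DD : 2 * (word (w i) *m p i) 0 0 * (word (w j) *m p j) 0 0 <= 2 * D * D.
  by apply: ler_pM; rewrite ?q0 ?Hw// ?mulr_ge0 ?q0// ler_wpM2l ?Hw.
apply: le_lt_trans DD _.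
have d0 : 1 / N%:R <= a j - a i.
  by rewrite /a -mulrBl ler_wpM2r ?invr_ge0 ?(ltW N0)// -natrB 1?ltnW// ler1n subn_gt0.
have d1 : a j - a i <= 1.
  rewrite /a -mulrBl ler_pdivrMr// mul1r -natrB 1?ltnW// ler_nat.
  by apply: leq_trans (leq_subr _ _) (ltnW jN).
set d := a j - a i in d0 d1 *.
have dp : 0 < d by apply: lt_le_trans d0; rewrite divr_gt0.
have cd : d ^+ 2 / 4 <= 1 - cos d.
  have := cos_le_deg4 d.
  have : d ^+ 4 <= d ^+ 2 by rewrite (_ : d ^+ 4 = d ^+ 2 * d ^+ 2); [rewrite ler_piMr ?sqr_ge0//; nra|ring].
  have := sqr_ge0 d; lra.
(* With the factor 3 the two points have product at least [1 + 9 / 4 D^2], more than the [2 D^2]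
   forced by a common element. *)
have Nd : 3 * D <= S * d.
  have h1 : S * (1 / N%:R) <= S * d by rewrite ler_wpM2l// ltW.
  apply: le_trans h1.
  rewrite mulrA mulr1 ler_pdivlMr// mulrC -ler_pdivlMr//; lra.
have : (3 * D) ^+ 2 <= (S * d) ^+ 2 by rewrite ler_pXn2r// nnegrE ?mulr_ge0//; lra.
rewrite exprMn (exprMn _ S) => h.
have : S ^+ 2 * (d ^+ 2 / 4) <= S ^+ 2 * (1 - cos d) by rewrite ler_wpM2l// sqr_ge0.
nra.
Qed.

End Growth.

(** * Upper bound for the orbit count *)

Lemma truncn_eq_dist (R : realType) (x y : R) : 0 <= x -> 0 <= y ->
  Num.truncn x = Num.truncn y -> `|x - y| <= 1.
Proof.
move=> x0 y0 E; have /andP[h1 h2] := truncn_itv x0; have /andP[h3 h4] := truncn_itv y0.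
rewrite -E -natr1 in h3 h4; rewrite -natr1 in h2.
by rewrite ler_norml; apply/andP; split; lra.
Qed.

Lemma cosh_sub (R : realType) (a b : R) :
  (expR a + expR (- a)) / 2 * ((expR b + expR (- b)) / 2) -
  (expR a - expR (- a)) / 2 * ((expR b - expR (- b)) / 2) =
  (expR (a - b) + expR (b - a)) / 2.
Proof. by rewrite !expRD; field. Qed.

Section OrbitCount.
Variables (R : realType) (n m : nat).
Hypotheses (n3 : (3 < n)%N) (m3 : (3 < m)%N) (m_even : ~~ odd m).
Hypothesis C1 : 1 < polygon_cosh R n m.
Implicit Types (x y z p q : 'cV[R]_3) (g h : 'M[R]_3).

Local Notation C := (polygon_cosh R n m).

(* Two orbit points in the same cell of a polar grid, of radial width [eta] and angular
   width [eta / T], are closer than the separation of the orbit. *)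
Lemma orbit_count_le : exists2 eta : R, 0 < eta & forall T : R, 1 <= T ->
  let A := [set g | Gamma n m g /\ g 0 0 <= T] in
  finite_set A /\
  (#|` fset_set A|)%:R <= (ln (2 * T) / eta + 1) * (8 * T / eta + 1).
Proof.
pose del := C - 1; have del0 : 0 < del by rewrite subr_gt0.
(* Within a cell the radial part of the product is at most [expR eta <= 1 + del / 2] and the angular
   part at most [eta ^+ 2 / 2 <= del / 4]; their sum stays below [C = 1 + del]. *)
pose eta := Num.min 1 (ln (1 + del / 2)).
have ln0 : 0 < ln (1 + del / 2) by rewrite ln_gt0//; lra.
have eta0 : 0 < eta by rewrite lt_min ltr01.
have eta1 : eta <= 1 by rewrite ge_min lexx.
have etad : expR eta <= 1 + del / 2.
  rewrite -[leRHS]lnK ?posrE; last lra.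
  by rewrite ler_expR /eta ge_min lexx orbT.
have eta_del : eta <= del / 2.
  by have := expR_ge1Dx eta; lra.
exists eta => // T T1 A.
have [th Hth] := choice (fun g : 'M[R]_3 =>
  let: ex_intro2 t h1 h2 := polar_coordinates ((g *m origin R) 1 0) ((g *m origin R) 2%:R 0) in
  ex_intro (fun t => (0 <= t <= 2 * pi) /\ _) t (conj h1 h2)).
pose z g := g *m origin R.
pose r g := Num.sqrt (z g 1 0 ^+ 2 + z g 2%:R 0 ^+ 2).
(* [z g 0 0] and [r g] are the hyperbolic cosine and sine of the distance to the origin, so [lam g]
   is its exponential. *)
pose lam g := z g 0 0 + r g.
have zH g : A g -> inH2 (z g).
  by case=> -[w ->] _; apply/word_mat_H2/origin_H2.
have r0 g : 0 <= r g by rewrite sqrtr_ge0.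
have rE g : r g ^+ 2 = z g 1 0 ^+ 2 + z g 2%:R 0 ^+ 2.
  by rewrite sqr_sqrtr// addr_ge0 ?sqr_ge0.
have zr g : A g -> (z g 0 0 - r g) * lam g = 1.
  move=> /zH/inH2P[_ E]; have := rE g; rewrite /lam => E2.
  have -> : (z g 0 0 - r g) * (z g 0 0 + r g) = z g 0 0 ^+ 2 - r g ^+ 2 by ring.
  by rewrite E E2; ring.
have z1 g : A g -> 1 <= z g 0 0 by move=> /zH; exact: inH2_ge1.
have lam1 g : A g -> 1 <= lam g by move=> /z1 h; have := r0 g; rewrite /lam; lra.
have rz g : A g -> r g <= z g 0 0.
  move=> Ag; have l1 := lam1 g Ag; have := zr g Ag.
  rewrite -subr_ge0 => E; rewrite -(pmulr_lge0 _ (lt_le_trans ltr01 l1)) E.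
  exact: ler01.
have zT g : A g -> z g 0 0 <= T by case=> _; rewrite /z mulmx_origin.
have lamT g : A g -> lam g <= 2 * T.
  by move=> Ag; have := rz g Ag; have := zT g Ag; rewrite /lam; lra.
pose N1 := (Num.truncn (ln (2 * T) / eta)).+1.
pose N2 := (Num.truncn (8 * T / eta)).+1.
pose c1 g := Num.truncn (ln (lam g) / eta).
pose c2 g := Num.truncn (th g * T / eta).
have c1N g : A g -> (c1 g < N1)%N.
  move=> Ag; rewrite ltnS; apply: le_truncn; rewrite ler_wpM2r ?invr_ge0 ?(ltW eta0)//.
  rewrite ler_ln ?posrE ?lamT//; last lra.
  exact: lt_le_trans (lam1 g Ag).
have th0 g : 0 <= th g by have [/andP[]] := Hth g.
have th8 g : th g <= 8.
  have [/andP[_ h] _] := Hth g; apply: le_trans h _.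
  by have := pi_lt_16_5 R; lra.
have c2N g : (c2 g < N2)%N.
  rewrite ltnS; apply: le_truncn; rewrite ler_wpM2r ?invr_ge0 ?(ltW eta0)//.
  by rewrite ler_wpM2r// (le_trans _ T1).
have T0 : 0 < T by apply: lt_le_trans T1.
have finj g h : A g -> A h -> c1 g = c1 h -> c2 g = c2 h -> g = h.
  move=> Ag Ah E1 E2; apply: contrapT => /eqP gh.
  have : C <= mink (z g) (z h).
    have [[u gu] _] := Ag; have [[w hw] _] := Ah.
    by rewrite /z gu hw; apply: orbit_sep => //; rewrite -gu -hw.
  apply/negP; rewrite -ltNge.
  have lg := lam1 g Ag; have lh := lam1 h Ah.
  have d1 : `|ln (lam g) - ln (lam h)| <= eta.
    have := truncn_eq_dist _ _ E1; rewrite -mulrBl normrM (gtr0_norm (x := eta^-1)) ?invr_gt0//.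
    rewrite ler_pdivrMr// mul1r; apply; rewrite divr_ge0 ?ln_ge0// ltW//.
  have d2 : `|th g - th h| <= eta / T.
    have := truncn_eq_dist _ _ E2.
    have -> : th g * T / eta - th h * T / eta = (th g - th h) * (T / eta) by ring.
    rewrite normrM (gtr0_norm (x := T / eta)) ?divr_gt0//.
    rewrite -ler_pdivlMr ?divr_gt0// mul1r invf_div; apply.
      by rewrite divr_ge0 ?mulr_ge0// ltW.
    by rewrite divr_ge0 ?mulr_ge0// ltW.
  have [_ [g1 g2]] := Hth g; have [_ [h1 h2]] := Hth h.
  rewrite -!/(z _) -!/(r _) in g1 g2 h1 h2.
  (* The hyperbolic law of cosines, split into the cosine of the difference of radii and an angular
     term. *)
  have -> : mink (z g) (z h) = (z g 0 0 * z h 0 0 - r g * r h) +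
      r g * r h * (1 - cos (th g - th h)).
    by rewrite minkE g1 g2 h1 h2 cosB; ring.
  have e1 : z g 0 0 * z h 0 0 - r g * r h <= expR eta.
    have zE k : A k -> z k 0 0 = (lam k + (lam k)^-1) / 2 /\ r k = (lam k - (lam k)^-1) / 2.
      move=> Ak; have -> : (lam k)^-1 = z k 0 0 - r k.
        apply: (@mulIf _ (lam k)); first by rewrite gt_eqF// (lt_le_trans ltr01)// lam1.
        by rewrite zr// mulVf// gt_eqF// (lt_le_trans ltr01)// lam1.
      by rewrite /lam; split; field.
    have [-> ->] := zE g Ag; have [-> ->] := zE h Ah.
    have [lg0 lh0] : lam g \in Num.pos /\ lam h \in Num.pos.
      by rewrite !posrE; split; apply: lt_le_trans ltr01 _.
    rewrite -(lnK lg0) -(lnK lh0) -!expRN.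
    rewrite cosh_sub; move: d1; rewrite ler_norml => /andP[d11 d12].
    set a := ln _ in d11 d12 *; set b := ln _ in d11 d12 *.
    have ab : expR (a - b) <= expR eta by rewrite ler_expR.
    have ba : expR (b - a) <= expR eta by rewrite ler_expR -opprB lerNl.
    by rewrite ler_pdivrMr// -natr1 mulrDr mulr1 lerD.
  have e2 : r g * r h * (1 - cos (th g - th h)) <= eta ^+ 2 / 2.
    have rr : r g * r h <= T * T.
      by apply: ler_pM => //; [apply: le_trans (rz g Ag) (zT g Ag)|apply: le_trans (rz h Ah) (zT h Ah)].
    have cc : 1 - cos (th g - th h) <= (eta / T) ^+ 2 / 2.
      have := cos_ge_deg2 (th g - th h).
      have : (th g - th h) ^+ 2 <= (eta / T) ^+ 2.
        by rewrite -real_normK ?num_real// ler_pXn2r// nnegrE ?divr_ge0// ltW.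
      lra.
    have c0 : 0 <= 1 - cos (th g - th h) by rewrite subr_ge0 cos_le1.
    apply: le_trans (ler_pM (mulr_ge0 (r0 g) (r0 h)) c0 rr cc) _.
    rewrite le_eqVlt; apply/orP; left; apply/eqP; field; lra.
  have : eta ^+ 2 <= eta by rewrite expr2 ler_piMr// ltW.
  rewrite /del in etad eta_del del0; lra.
have [] := @card_fset_set_le _ A (N1 * N2)%N (fun g => (c1 g * N2 + c2 g)%N).
- move=> g Ag; apply: (@leq_trans ((c1 g).+1 * N2)%N).
    by rewrite mulSn addnC ltn_add2r.
  by rewrite leq_mul2r c1N ?orbT.
- move=> g h Ag Ah E.
  have h1 : c1 g = c1 h.
    have := congr1 (divn^~ N2) E.
    by rewrite !divnMDl// !divn_small// !addn0.
  by apply: finj => //; move: E; rewrite h1 => /addnI.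
move=> finA cardA; split => //.
apply: (@le_trans _ _ (N1 * N2)%:R); first by rewrite ler_nat.
have lT : 0 <= ln (2 * T) / eta by rewrite divr_ge0 ?ln_ge0 ?(ltW eta0)//; lra.
have eT : 0 <= 8 * T / eta by rewrite divr_ge0 ?mulr_ge0 ?(ltW eta0) ?(ltW T0).
have /andP[h1 _] := truncn_itv lT; have /andP[h2 _] := truncn_itv eT.
rewrite natrM; apply: ler_pM => //.
  by rewrite -(natr1 (Num.truncn (ln (2 * T) / eta))) lerD2r.
by rewrite -(natr1 (Num.truncn (8 * T / eta))) lerD2r.
Qed.

End OrbitCount.

(** * Growth rate of the balls *)

Section BallGrowth.
Variables (R : realType) (n m : nat).
Hypotheses (n3 : (3 < n)%N) (m3 : (3 < m)%N) (m_even : ~~ odd m).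
Hypothesis C1 : 1 < polygon_cosh R n m.
Implicit Types (x y z p q : 'cV[R]_3) (g h : 'M[R]_3).

Local Notation C := (polygon_cosh R n m).

Lemma hdist_bounds x y : inH2 x -> inH2 y ->
  ln (mink x y) <= hdist x y <= ln (2 * mink x y).
Proof.
move=> hx hy; have M1 := mink_ge1 hx hy; rewrite /hdist.
set M := mink x y in M1 *.
have M2 : 1 <= M ^+ 2 by rewrite expr_ge1//; lra.
have s0 : 0 <= Num.sqrt (M ^+ 2 - 1) by rewrite sqrtr_ge0.
have s1 : Num.sqrt (M ^+ 2 - 1) <= M.
  rewrite -(@ler_pXn2r _ 2)// ?nnegrE//; last lra.
  by rewrite sqr_sqrtr; lra.
by rewrite !ler_ln ?posrE; try lra; apply/andP; split; lra.
Qed.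

Lemma ball_growth x0 : inH2 x0 ->
  (fun k : nat => ln ((ball_card n m x0 k)%:R : R) / k%:R) @ \oo --> (1 : R).
Proof.
move=> hx; have [x00 _] := inH2P hx; have x1 := inH2_ge1 hx.
pose X := 4 * x0 0 0 ^+ 2.
have X4 : 4 <= X by rewrite /X ler_peMr// expr_ge1// ltW.
have [eta eta0 Hup] := orbit_count_le n3 m3 m_even C1.
have [D D1 Hlow] := orbit_count_ge n3 m3 C1.
pose B k := [set g | Gamma n m g /\ hdist x0 (g *m x0) <= k%:R].
have e0 k : 0 < expR k%:R :> R by apply: expR_gt0.
have e1 (k : nat) : 1 <= expR k%:R :> R by have := expR_ge1Dx (k%:R : R); have : 0 <= k%:R :> R by []; lra.
have BA k : B k `<=` [set g | Gamma n m g /\ g 0 0 <= X * expR k%:R].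
  move=> g [Gg hg]; split => //; have [w gw] := Gg.
  have wx : inH2 (g *m x0) by rewrite gw; apply: word_mat_H2.
  have /andP[h1 _] := hdist_bounds hx wx.
  rewrite gw; apply: le_trans (mink_orbit_ge C1 w hx) _; rewrite -gw.
  rewrite -/X ler_wpM2l//; first lra.
  by rewrite -[leLHS]lnK ?posrE ?mink_gt0// ler_expR (le_trans h1).
have AB k g : Gamma n m g -> g 0 0 <= expR k%:R / (2 * X) -> B k g.
  move=> Gg hg; split => //; have [w gw] := Gg.
  have wx : inH2 (g *m x0) by rewrite gw; apply: word_mat_H2.
  have /andP[_ h1] := hdist_bounds hx wx; apply: le_trans h1 _.
  rewrite -[leRHS]expRK ler_ln ?posrE ?mulr_gt0 ?mink_gt0//.
  have := mink_orbit_le C1 w hx; rewrite -gw -/X => h2.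
  have : 2 * (X * g 0 0) <= expR k%:R.
    by move: hg; rewrite ler_pdivlMr; lra.
  lra.
have XT k : 1 <= X * expR k%:R by have := e1 k; nra.
have finB k : finite_set (B k).
  by have [fA _] := Hup _ (XT k); apply: sub_finite_set fA.
have upper k : (ball_card n m x0 k)%:R <=
    ((eta^-1 * k%:R + (ln (2 * X) / eta + 1)) * ((8 * X / eta + 1) * expR k%:R)).
  have [fA cA] := Hup _ (XT k).
  have : (ball_card n m x0 k)%:R <= (#|` fset_set [set g | Gamma n m g /\ g 0 0 <= X * expR k%:R]|)%:R :> R.
    rewrite ler_nat; apply: fsubset_leq_card.
    by have := BA k; rewrite (fset_set_sub (finB k) fA).
  move=> /le_trans; apply; apply: le_trans cA _.
  have lnE : ln (2 * (X * expR k%:R)) = ln (2 * X) + k%:R.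
    by rewrite mulrA lnM ?posrE ?expRK//; lra.
  rewrite lnE; apply: ler_pM.
  - rewrite addr_ge0// divr_ge0 ?(ltW eta0)// addr_ge0// ln_ge0//; lra.
  - rewrite addr_ge0// divr_ge0 ?(ltW eta0)// mulr_ge0//; have := XT k; lra.
  - by rewrite mulrDl addrAC addrA [eta^-1 * _]mulrC; lra.
  - have := e1 k; have : 8 * (X * expR k%:R) / eta = 8 * X / eta * expR k%:R by ring.
    lra.
(* Chosen so that [2 D (1 + S) = expR k / (2 X)], the height that guarantees membership in the
   ball. *)
pose S k := expR k%:R / (4 * X * D) - 1.
pose N k := Num.truncn (S k / (3 * D)).
have lower k : (N k <= ball_card n m x0 k)%N.
  have [S0|S0] := leP (S k) 0.
    rewrite /N (_ : Num.truncn _ = 0%N)//; apply/truncn0Pn; rewrite -ltNge.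
    apply: le_lt_trans ltr01; rewrite pmulr_lle0// invr_gt0; lra.
  have SD : 0 <= S k / (3 * D) by rewrite divr_ge0 ?(ltW S0)//; lra.
  have /andP[NS _] := truncn_itv SD.
  have [f [fG [fD finj]]] := Hlow (S k) (N k) S0 NS.
  apply: (@card_fset_set_ge _ _ (N k) f (finB k) _ finj) => i _; apply: AB => //.
  apply: le_trans (fD i) _; rewrite /S addrC subrK le_eqVlt; apply/orP; left.
  by apply/eqP; field; lra.
(* [S / (3 D)] is [4 expR k / (48 X D^2) - 1 / (3 D)]; three quarters of the main term absorb the
   two rounding losses once [k > M]. *)
pose M := ln (48 * X * D ^+ 2).
have D2 : 1 <= D ^+ 2 by rewrite expr_ge1//; lra.
have XD : 1 <= 48 * X * D ^+ 2 by nra.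
have M0 : 0 <= M by rewrite ln_ge0.
have ln_lower k : k%:R - M <= ln (ball_card n m x0 k)%:R.
  (* For small [k] the bound is trivial, even for a zero count, because [ln 0 = 0]. *)
  have [kM|kM] := leP (k%:R : R) M.
    apply: (@le_trans _ _ 0); first by rewrite subr_le0.
    by case: (ball_card _ _ _ _) => [|c]; [rewrite ln0|rewrite ln_ge0// ler1n].
  have eM : 48 * X * D ^+ 2 < expR k%:R.
    by rewrite -ltr_ln ?posrE ?expRK//; lra.
  have : expR k%:R / (48 * X * D ^+ 2) <= (ball_card n m x0 k)%:R.
    apply: (@le_trans _ _ (N k)%:R); last by rewrite ler_nat.
    have SD : 0 <= S k / (3 * D).
      rewrite divr_ge0//; last lra.
      rewrite subr_ge0 ler_pdivlMr; last nra.
      by apply: le_trans (ltW eM); nra.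
    have /andP[_ NS] := truncn_itv SD; rewrite -(natr1 (Num.truncn _)) -/(N k) in NS.
    have E1 : S k / (3 * D) = 4 * (expR k%:R / (48 * X * D ^+ 2)) - 1 / (3 * D).
      by rewrite /S; field; lra.
    have E2 : 1 <= expR k%:R / (48 * X * D ^+ 2) by rewrite ler_pdivlMr ?mul1r ?(ltW eM)//; lra.
    have E3 : 1 / (3 * D) <= 1 by rewrite ler_pdivrMr; lra.
    rewrite E1 in NS; lra.
  move=> h; rewrite -[leLHS]expRK expRB lnK ?posrE; last lra.
  have e3 : 0 < expR k%:R / (48 * X * D ^+ 2) by rewrite divr_gt0//; lra.
  by rewrite ler_ln ?posrE// (lt_le_trans e3 h).
pose b := ln (2 * X) / eta + 1.
pose Q := 8 * X / eta + 1.
have b1 : 1 <= b by rewrite lerDr divr_ge0 ?(ltW eta0)// ln_ge0//; lra.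
have Q1 : 1 <= Q by rewrite lerDr divr_ge0 ?(ltW eta0)//; lra.
have ei0 : 0 <= eta^-1 by rewrite invr_ge0 ltW.
have ln_upper k : ln (ball_card n m x0 k)%:R <= ln (eta^-1 * k%:R + b) + (ln Q + k%:R).
  have akb : 1 <= eta^-1 * k%:R + b by rewrite -[leLHS]add0r lerD// mulr_ge0.
  have Q0 : 0 < Q by apply: lt_le_trans Q1.
  have akb0 : 0 < eta^-1 * k%:R + b by apply: lt_le_trans akb.
  have -> : ln Q + k%:R = ln (Q * expR k%:R) by rewrite lnM ?posrE ?expRK.
  rewrite -lnM ?posrE ?(mulr_gt0 Q0)//.
  have := upper k; case: (ball_card _ _ _ _) => [|c] h.
    by rewrite ln0// ln_ge0// !mulr_ege1.
  by rewrite ler_ln// posrE ?ltr0n// (lt_le_trans _ h).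
have lim0 : (fun k : nat => ln (eta^-1 * k%:R + b) / k%:R + (k.+1%:R)^-1 * (2 * (M + ln Q)))
    @ \oo --> (0 : R).
  have -> : 0 = 0 + 0 * (2 * (M + ln Q)) by rewrite mul0r addr0.
  apply: cvgD; first exact: cvg_ln_affine.
  by apply: cvgMr_tmp; exact: cvg_harmonic.
have LQ : 0 <= ln Q by rewrite ln_ge0.
have squeeze (k L A : R) : 0 < k -> k - M <= L -> L <= A + (ln Q + k) -> 0 <= A ->
    `|1 - L / k| <= (A + (M + ln Q)) / k.
  move=> kp h1 h2 A0; have -> : 1 - L / k = (k - L) / k by field; rewrite gt_eqF.
  rewrite normf_div (gtr0_norm kp) ler_wpM2r ?invr_ge0 ?(ltW kp)//.
  by rewrite ler_norml; apply/andP; split; lra.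
apply/cvgrPdist_le => e ep; move/cvgrPdist_le: lim0 => /(_ _ ep) He.
near=> k.
have k0 : (0 < k)%N by near: k; exists 1%N.
have kR : 0 < k%:R :> R by rewrite ltr0n.
have Hek : `|0 - (ln (eta^-1 * k%:R + b) / k%:R + k.+1%:R^-1 * (2 * (M + ln Q)))| <= e.
  by near: k; exact: He.
rewrite sub0r normrN in Hek; have {}Hek := le_trans (ler_norm _) Hek.
apply: le_trans Hek.
have La : 0 <= ln (eta^-1 * k%:R + b).
  by rewrite ln_ge0// -[leLHS]add0r lerD// mulr_ge0.
have kk : (M + ln Q) / k%:R <= k.+1%:R^-1 * (2 * (M + ln Q)).
  have -> : k.+1%:R^-1 * (2 * (M + ln Q)) = (M + ln Q) * (2 / k.+1%:R) by ring.
  rewrite ler_wpM2l ?addr_ge0// ler_pdivlMr ?ltr0n// mulrC ler_pdivrMr//.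
  by rewrite -natrM ler_nat mul2n -addnn -addn1 leq_add2l.
apply: (@le_trans _ _ ((ln (eta^-1 * k%:R + b) + (M + ln Q)) / k%:R)); last first.
  by rewrite mulrDl lerD2l.
exact: squeeze kR (ln_lower k) (ln_upper k) La.
Unshelve. all: by end_near. Qed.

End BallGrowth.

(** * Drift *)

Section Drift.
Variables (R : realType) (n m : nat).
Hypothesis n3 : (3 < n)%N.
Hypothesis C1 : 1 < polygon_cosh R n m.
Implicit Types (x y z p q : 'cV[R]_3) (w u : seq 'I_n).

Local Notation word w := (word_mat n m w : 'M[R]_3).

Let n0 : (0 < n)%N. Proof. exact: leq_trans n3. Qed.

(** The factor 2 matches the one in [word_mat_cat_le] and makes the sequence subadditive. *)
Let a k := avg k (fun w => ln (2 * word w 0 0)).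

Let word2_gt1 w : 1 <= 2 * word w 0 0.
Proof. have := word_mat_ge1 C1 w; lra. Qed.

Lemma log_orbit_ge0 k : 0 <= a k.
Proof. by apply: avg_ge0 => // w _; rewrite ln_ge0. Qed.

Lemma log_orbitD j k : a (j + k) <= a j + a k.
Proof.
rewrite /a avg_cat.
rewrite -[X in _ + X](avg_cst n0 j) -avgD; apply: le_avg => u hu.
rewrite -[X in X + _](avg_cst n0 k) -avgD; apply: le_avg => w hw.
have wu := word2_gt1 u; have ww := word2_gt1 w; have wuw := word2_gt1 (u ++ w).
have wu0 := lt_le_trans ltr01 wu; have ww0 := lt_le_trans ltr01 ww.
have wuw0 := lt_le_trans ltr01 wuw; have mm0 := mulr_gt0 wu0 ww0.
by rewrite -lnM ?posrE// ler_ln ?posrE//; have := word_mat_cat_le C1 u w; lra.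
Qed.

Lemma drift_kE x0 k : drift_k n m x0 k = avg k (fun w => hdist x0 (word w *m x0)).
Proof. by []. Qed.

(** The second half is a Lyapunov criterion: iterating the mean gain [c] of [V] from the origin
    bounds [k c] by [t] times the mean log-height plus a constant. The freedom in [V] and [t] allows
    several steps to be averaged. *)
Lemma drift_cvg x0 : inH2 x0 -> exists2 l : R,
  (fun k : nat => drift_k n m x0 k / k%:R) @ \oo --> l &
  forall (V : 'cV[R]_3 -> R) (t K c : R), 0 <= t ->
    (forall y, inH2 y -> V y <= t * ln (y 0 0) + K) ->
    (forall y, inH2 y -> V y + c <= n%:R^-1 * \sum_i V (gen n m i *m y)) ->
    c <= t * l.
Proof.
move=> hx; have [l al lle] := subadditive_cvg log_orbit_ge0 log_orbitD.
have x1 := inH2_ge1 hx.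
pose X := 4 * x0 0 0 ^+ 2.
have X4 : 4 <= X by rewrite /X ler_peMr// expr_ge1// ltW// (lt_le_trans ltr01).
exists l.
  apply: (@cvg_div_nat_bounded _ a _ (ln (2 * X))) => // k.
  rewrite ler_norml drift_kE /a; apply/andP; split.
    rewrite lerNl opprB lerBlDl -[X in _ + X](avg_cst n0 k) -avgD.
    apply: le_avg => w _.
    have w1 := word_mat_ge1 C1 w; have hw := word_mat_H2 C1 w hx.
    have /andP[_ h] := hdist_bounds hx hw.
    have M0 := mink_gt0 hx hw; have := mink_orbit_le C1 w hx; rewrite -/X => hX.
    apply: le_trans h _; rewrite -lnM ?posrE; try lra.
    by rewrite ler_ln ?posrE; nra.
  rewrite lerBlDr -[X in X + _](avg_cst n0 k) -avgD.
  apply: le_avg => w _.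
  have w1 := word_mat_ge1 C1 w; have hw := word_mat_H2 C1 w hx.
  have /andP[h _] := hdist_bounds hx hw.
  have M0 := mink_gt0 hx hw; have := mink_orbit_ge C1 w hx; rewrite -/X => hX.
  have : ln (2 * word w 0 0) <= ln (2 * X) + ln (mink x0 (word w *m x0)).
    rewrite -lnM ?posrE; try lra.
    by rewrite ler_ln ?posrE; nra.
  lra.
move=> V t K c t0 VK Vc.
have step k y : inH2 y -> V y + k%:R * c <= avg k (fun w => V (word w *m y)).
  move=> hy; elim: k => [|k IH]; first by rewrite avg0 /= mul1mx mul0r addr0.
  rewrite avgS_last -natr1 mulrDl mul1r addrA.
  apply: (@le_trans _ _ (avg k (fun w => V (word w *m y) + c))).
    by rewrite avgD avg_cst// lerD2r.
  apply: le_avg => w _; apply: le_trans (Vc _ (word_mat_H2 C1 w hy)) _.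
  by rewrite ler_wpM2l ?invr_ge0// ler_sum// => i _; rewrite /= mulmxA.
have ub k : k%:R * c <= t * a k + (K - V (origin R)).
  have := step k _ (origin_H2 R) => h.
  have : avg k (fun w => V (word w *m origin R)) <= t * a k + K.
    rewrite /a -avgZ -[X in _ + X](avg_cst n0 k) -avgD; apply: le_avg => w _.
    apply: le_trans (VK _ (word_mat_H2 C1 w (origin_H2 R))) _.
    rewrite lerD2r ler_wpM2l// mulmx_origin.
    have w1 := word_mat_ge1 C1 w.
    by rewrite ler_ln ?posrE; lra.
  lra.
have lim : (fun k : nat => t * (a k.+1 / k.+1%:R) + (k.+1%:R)^-1 * (K - V (origin R)))
    @ \oo --> (t * l : R).
  have -> : t * l = t * l + 0 * (K - V (origin R)) by rewrite mul0r addr0.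
  apply: cvgD.
    by apply: cvgMl_tmp; rewrite (cvg_shiftS (fun k => a k / k%:R)).
  by apply: cvgMr_tmp; exact: cvg_harmonic.
rewrite -(cvg_lim _ lim)//; apply: limr_ge; first by apply/cvg_ex; exists (t * l).
apply: nearW => k.
have kR : 0 < k.+1%:R :> R by rewrite ltr0n.
rewrite mulrA [_^-1 * _]mulrC -mulrDl ler_pdivlMr// mulrC; exact: ub.
Qed.

End Drift.

(** * Products over the roots of unity *)

Local Open Scope complex_scope.

Section RootsOfUnityProduct.
Variable R : realType.
Implicit Types (t u c s : R) (x y : R[i]).

Definition cis t : R[i] := cos t +i* sin t.

Lemma cisD t u : cis (t + u) = cis t * cis u.
Proof. by rewrite /cis cosD sinD; simpc; congr (_ +i* _); ring. Qed.

Lemma cisX t k : cis t ^+ k = cis (k%:R * t).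
Proof.
elim: k => [|k IH]; first by rewrite mul0r /cis cos0 sin0.
by rewrite exprS IH -cisD -natr1 mulrDl mul1r addrC.
Qed.

Definition sqnorm x : R := complex.Re x ^+ 2 + complex.Im x ^+ 2.

Lemma sqnormM x y : sqnorm (x * y) = sqnorm x * sqnorm y.
Proof. by case: x y => [a b] [c d]; rewrite /sqnorm; simpc => /=; ring. Qed.

Lemma cis_primitive_root (n : nat) : (0 < n)%N ->
  n.-primitive_root (cis (2 * pi / n%:R)).
Proof.
move=> n0; have nR : 0 < n%:R :> R by rewrite ltr0n.
apply/andP; split => //; apply/forallP => i; rewrite unity_rootE cisX.
have [->|ni] := eqVneq i.+1 n.
  have -> : n%:R * (2 * pi / n%:R) = pi *+ 2 :> R.
    by rewrite -[RHS]mulr_natl; field; rewrite gt_eqF.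
  by rewrite /cis cos2pi sin2pi !eqxx.
rewrite eqbF_neg; apply/eqP => E; have : cos (i.+1%:R * (2 * pi / n%:R)) = 1 :> R.
  by have /(congr1 (@complex.Re R)) := E.
have -> : i.+1%:R * (2 * pi / n%:R) = (i.+1%:R * (pi / n%:R)) *+ 2 :> R.
  by rewrite -[RHS]mulr_natr; ring.
rewrite cos_mulr2n cos2sin2 => /eqP; rewrite -subr_eq0 -mulr_natr => /eqP E1.
have pg := pi_gt0 R.
have : 0 < sin (i.+1%:R * (pi / n%:R)) :> R.
  apply: sin_gt0_pi; apply/andP; split; first by rewrite mulr_gt0// divr_gt0.
  rewrite mulrA ltr_pdivrMr// mulrC ltr_pM2l// ltr_nat.
  by have := ltn_ord i; move/eqP: ni; lia.
move=> sp; have : 0 < sin (i.+1%:R * (pi / n%:R)) ^+ 2 :> R by rewrite exprn_gt0.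
lra.
Qed.

(** The circle theorem of Cotes and de Moivre: with [z = s cis (- t)] and [w = cis (2 pi / n)], the
    factors are the squared moduli of [c - z w^i], whose product is [c^n - z^n]. *)
Lemma prod_circle (n : nat) (c s t : R) : (0 < n)%N -> 0 < s ->
  \prod_(i < n) (c ^+ 2 + s ^+ 2 - 2 * c * s * cos (t - 2 * pi * i%:R / n%:R)) =
  c ^+ n ^+ 2 + s ^+ n ^+ 2 - 2 * c ^+ n * s ^+ n * cos (n%:R * t).
Proof.
move=> n0 s0; pose w := cis (2 * pi / n%:R).
pose z := s%:C * cis (- t).
have z0 : z != 0.
  rewrite mulf_neq0//; first by rewrite eq_complex /= gt_eqF.
  apply/eqP => E; have := cos2Dsin2 (- t); move: E => [-> ->]; rewrite expr0n addr0 => /eqP.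
  by rewrite eq_sym oner_eq0.
have factor i : c ^+ 2 + s ^+ 2 - 2 * c * s * cos (t - 2 * pi * i%:R / n%:R) =
    sqnorm (c%:C - z * w ^+ i).
  have -> : z * w ^+ i = s%:C * cis (- (t - 2 * pi * i%:R / n%:R)).
    by rewrite /z /w cisX -[LHS]mulrA -cisD; congr (_ * cis _); ring.
  rewrite /cis cosN sinN /sqnorm; simpc => /=.
  have := cos2Dsin2 (t - 2 * pi * i%:R / n%:R).
  set a := cos _; set b := sin _ => ab.
  have -> : s ^+ 2 = s ^+ 2 * (a ^+ 2 + b ^+ 2) by rewrite ab mulr1.
  by ring.
under eq_bigr do rewrite factor.
rewrite -(big_morph sqnorm sqnormM (_ : sqnorm 1 = 1)); last first.
  by rewrite /sqnorm /= expr1n expr0n addr0.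
have -> : \prod_(i < n) (c%:C - z * w ^+ i) = (c ^+ n)%:C - z ^+ n.
  have := factor_Xn_sub_1 (cis_primitive_root n0) => /(congr1 (horner^~ (c%:C / z))).
  rewrite horner_prod !hornerE big_mkord => E.
  have -> : (c ^+ n)%:C - z ^+ n = z ^+ n * ((c%:C / z) ^+ n - 1).
    rewrite mulrBr mulr1 expr_div_n mulrC divfK ?expf_neq0//.
    by rewrite rmorphXn.
  rewrite -E -[n in z ^+ n]card_ord -prodr_const -big_split /=.
  apply: eq_bigr => i _; rewrite !hornerE mulrBr; congr (_ - _).
  by rewrite mulrC divfK.
rewrite /z exprMn cisX -rmorphXn /cis mulrN cosN sinN /sqnorm; simpc => /=.
have := cos2Dsin2 (n%:R * t); set a := cos _; set b := sin _ => ab.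
have -> : s ^+ n ^+ 2 = s ^+ n ^+ 2 * (a ^+ 2 + b ^+ 2) by rewrite ab mulr1.
by ring.
Qed.

End RootsOfUnityProduct.
Local Close Scope complex_scope.

(** * Mean gain of height in one step *)

Lemma convex_comb_gt0 (R : realType) (k x y : R) : 0 <= k <= 1 -> 0 < x -> 0 < y ->
  0 < k * x + (1 - k) * y.
Proof.
move=> /andP[k0 k1] x0 y0.
have [->|kn] := eqVneq k 0; first by lra.
by rewrite ltr_wpDr ?mulr_ge0 ?subr_ge0 ?(ltW y0)// mulr_gt0// lt_neqAle eq_sym kn.
Qed.

(** Both values of [ln] lie below its tangent at the convex combination. *)
Lemma ln_convex_comb (R : realType) (k x y : R) : 0 <= k <= 1 -> 0 < x -> 0 < y ->
  k * ln x + (1 - k) * ln y <= ln (k * x + (1 - k) * y).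
Proof.
move=> k01 x0 y0; have z0 := convex_comb_gt0 k01 x0 y0; case/andP: k01 => k0 k1.
set z := k * x + _ in z0 *.
have lnle u : 0 < u -> ln u <= ln z + (u / z - 1).
  move=> u0; have uz : 0 < u / z by rewrite divr_gt0.
  have := @le_ln1Dx R (u / z - 1); rewrite (addrC 1) subrK ln_div ?posrE// => h.
  have : -1 < u / z - 1 by lra.
  by move/h; lra.
have hx : k * ln x <= k * (ln z + (x / z - 1)) by rewrite ler_wpM2l// lnle.
have hy : (1 - k) * ln y <= (1 - k) * (ln z + (y / z - 1)).
  by rewrite ler_wpM2l ?subr_ge0// lnle.
have : k * (x / z) + (1 - k) * (y / z) = 1.
  by rewrite !mulrA -mulrDl divff// gt_eqF.
lra.
Qed.

Lemma sum_ln (R : realType) (n : nat) (f : 'I_n -> R) : (forall i, 0 < f i) ->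
  \sum_(i < n) ln (f i) = ln (\prod_(i < n) f i).
Proof.
move=> f0; apply: expR_inj; rewrite expR_sum lnK ?posrE ?prodr_gt0//.
by apply: eq_bigr => i _; rewrite lnK ?posrE.
Qed.

Section OneStep.
Variables (R : realType) (n m : nat).
Hypothesis n3 : (3 < n)%N.
Hypothesis C1 : 1 < polygon_cosh R n m.
Implicit Types (x y z : 'cV[R]_3) (i : 'I_n).

Local Notation C := (polygon_cosh R n m).
Local Notation s := (polygon_sinh R n m).

Lemma gen_height i y : (gen n m i *m y) 0 0 = (C ^+ 2 + s ^+ 2) * y 0 0 -
  2 * C * s * (y 1 0 * cos (side_angle R i) + y 2%:R 0 * sin (side_angle R i)).
Proof.
rewrite gen_mulE minkE !side_normalE.
have -> : C ^+ 2 = 1 + s ^+ 2 by rewrite (polygon_sinhE C1); ring.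
ring.
Qed.

Lemma cosh_gt_sinh : s < C.
Proof.
have s0 := polygon_sinh_gt0 C1; have sE := polygon_sinhE C1.
rewrite -(@ltr_pXn2r _ 2)// ?nnegrE ?(ltW s0)//; last by apply/ltW/(lt_trans ltr01).
by rewrite sE; lra.
Qed.

(* The logarithm of the height is concave along the diameter through [y], which reduces the
   bound to the two endpoints at infinity; there [prod_circle] computes the sum exactly. *)
Lemma one_step_bound y : inH2 y ->
  n%:R * ln (y 0 0) + 2 * ln (C ^+ n - s ^+ n) <= \sum_i ln ((gen n m i *m y) 0 0).
Proof.
move=> hy; have [y0 yE] := inH2P hy.
have s0 := polygon_sinh_gt0 C1; have sC := cosh_gt_sinh.
have C0 : 0 < C by apply: lt_trans s0 sC.
have [t _ [y1E y2E]] := polar_coordinates (y 1 0) (y 2%:R 0).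
set r := Num.sqrt _ in y1E y2E.
have r0 : 0 <= r by rewrite sqrtr_ge0.
have ry : r <= y 0 0.
  rewrite -(@ler_pXn2r _ 2)// ?nnegrE ?(ltW y0)// sqr_sqrtr ?addr_ge0 ?sqr_ge0//.
  by rewrite yE; lra.
(* Divided by the height, the spatial part of [y] is the combination, with weights [k] and [1 - k],
   of the unit vectors at the angles [t] and [t + pi]. *)
pose k := (1 + r / y 0 0) / 2.
have ry01 : 0 <= r / y 0 0 <= 1.
  by rewrite divr_ge0 ?(ltW y0)//= ler_pdivrMr// mul1r.
have k01 : 0 <= k <= 1 by rewrite /k; apply/andP; split; lra.
(* The factor by which reflection [i] multiplies heights near the boundary point of direction
   [u]. *)
pose f u i := C ^+ 2 + s ^+ 2 - 2 * C * s * cos (u - side_angle R i).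
have f0 u i : 0 < f u i.
  have : 0 < (C - s) ^+ 2 by rewrite exprn_gt0// subr_gt0.
  have : 0 <= C * s by apply: mulr_ge0; exact: ltW.
  have := cos_le1 (u - side_angle R i).
  rewrite /f; move: (cos _) => c c1 cs0.
  have : 0 <= (C * s) * (1 - c) by apply: mulr_ge0; rewrite // subr_ge0.
  lra.
have Cs : 0 < C ^+ n - s ^+ n.
  by rewrite subr_gt0 ltr_pXn2r// ?nnegrE ?ltW//; apply: leq_trans n3.
(* The product of the factors is [(C^n - s^n)^2 + 2 C^n s^n (1 - cos (n u))], least when [u] points
   to the middle of a side. *)
have sumf u : 2 * ln (C ^+ n - s ^+ n) <= \sum_i ln (f u i).
  rewrite sum_ln// /f prod_circle//; last by apply: leq_trans n3.
  rewrite mulr_natl -lnXn// ler_ln ?posrE ?exprn_gt0//; last first.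
    by rewrite -prod_circle//; [apply: prodr_gt0 => i _; exact: f0|apply: leq_trans n3].
  have : 0 <= C ^+ n * s ^+ n by apply: mulr_ge0; apply: exprn_ge0; exact: ltW.
  have := cos_le1 (n%:R * u); move: (cos _) (C ^+ n) (s ^+ n) => c A B c1 AB.
  have : 0 <= (A * B) * (1 - c) by apply: mulr_ge0; rewrite // subr_ge0.
  lra.
have key i : ln (y 0 0) + (k * ln (f t i) + (1 - k) * ln (f (t + pi) i)) <=
    ln ((gen n m i *m y) 0 0).
  have g0 := (inH2P (gen_H2 C1 i hy)).1.
  have -> : (gen n m i *m y) 0 0 = y 0 0 * (k * f t i + (1 - k) * f (t + pi) i).
    have -> : f (t + pi) i = C ^+ 2 + s ^+ 2 + 2 * C * s * cos (t - side_angle R i).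
      by rewrite /f (addrAC t) cosDpi; ring.
    by rewrite gen_height// {1}y1E {1}y2E /f cosB /k; field; rewrite gt_eqF.
  rewrite lnM ?posrE//; last exact: convex_comb_gt0.
  by rewrite lerD2l ln_convex_comb.
apply: le_trans (ler_sum _ (fun i _ => key i)).
rewrite big_split/= sumr_const card_ord -[ln _ *+ n]mulr_natl lerD2l.
rewrite big_split/= -!mulr_sumr.
have h1 := sumf t; have h2 := sumf (t + pi); case/andP: k01 => k0 k1.
have : k * (2 * ln (C ^+ n - s ^+ n)) <= k * \sum_i ln (f t i) by rewrite ler_wpM2l.
have : (1 - k) * (2 * ln (C ^+ n - s ^+ n)) <= (1 - k) * \sum_i ln (f (t + pi) i).
  by rewrite ler_wpM2l// subr_ge0.
lra.
Qed.

End OneStep.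

(** * Reduction to numerical inequalities *)

Section Criterion.
Variables (R : realType) (n m : nat).
Hypotheses (n3 : (3 < n)%N) (m3 : (3 < m)%N) (m_even : ~~ odd m).
Hypothesis C1 : 1 < polygon_cosh R n m.

Local Notation C := (polygon_cosh R n m).
Local Notation s := (polygon_sinh R n m).

Definition strict_fundamental_inequality (x0 : 'cV[R]_3) := exists h l v : R,
  (fun k : nat => @entropy_k R n m k / k%:R) @ \oo --> h /\
  (fun k : nat => drift_k n m x0 k / k%:R) @ \oo --> l /\
  (fun k : nat => ln ((ball_card n m x0 k)%:R : R) / k%:R) @ \oo --> v /\
  h < l * v.

Lemma drift_criterion x0 (V : 'cV[R]_3 -> R) (t K c : R) : inH2 x0 -> 0 < t ->
  (forall y, inH2 y -> V y <= t * ln (y 0 0) + K) ->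
  (forall y, inH2 y -> V y + c <= n%:R^-1 * \sum_i V (gen n m i *m y)) ->
  t * ((n%:R - 2) / n%:R * ln (n%:R - 1)) < c ->
  strict_fundamental_inequality x0.
Proof.
move=> hx t0 VK Vc hc.
have [h hh hle] := entropy_cvg n3 (genK C1).
have [l ll lge] := drift_cvg n3 C1 hx.
exists h, l, 1; split => //; split => //; split; first exact: ball_growth.
rewrite mulr1; apply: le_lt_trans hle _.
have := lge V t K c (ltW t0) VK Vc => hl.
by rewrite -(ltr_pM2l t0); apply: lt_le_trans hc hl.
Qed.

Lemma power_criterion x0 : inH2 x0 ->
  (n%:R - 1) ^+ (n - 2) < (C ^+ n - s ^+ n) ^+ 2 ->
  strict_fundamental_inequality x0.
Proof.
move=> hx H; have nR : 4 <= n%:R :> R by rewrite ler_nat.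
apply: (@drift_criterion x0 (fun y => ln (y 0 0)) 1 0 (2 / n%:R * ln (C ^+ n - s ^+ n))) => //.
- by move=> y hy; rewrite mul1r addr0.
- move=> y hy; have := one_step_bound n3 C1 hy => h.
  rewrite [leRHS]mulrC ler_pdivlMr; last lra.
  apply: le_trans h; rewrite le_eqVlt; apply/orP; left; apply/eqP; field; lra.
have Cs : 0 < C ^+ n - s ^+ n.
  have s0 := polygon_sinh_gt0 C1; have sC := cosh_gt_sinh C1.
  rewrite subr_gt0 ltr_pXn2r// ?nnegrE ?(ltW s0)//; last by apply/ltW/(lt_trans s0).
  exact: leq_trans n3.
have : ln ((n%:R - 1) ^+ (n - 2)) < ln ((C ^+ n - s ^+ n) ^+ 2).
  by rewrite ltr_ln// posrE exprn_gt0//; lra.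
rewrite !lnXn//; last lra.
rewrite -[_ *+ (n - 2)]mulr_natl natrB; last by apply: ltnW; apply: ltnW.
rewrite -[_ *+ 2]mulr_natl mul1r => h.
rewrite mulrAC ltr_pdivrMr; last lra.
apply: lt_le_trans h _; rewrite le_eqVlt; apply/orP; left; apply/eqP; field; lra.
Qed.

End Criterion.

(** * Numerical comparison *)

Section PowerInequalities.
Variable R : realType.
Implicit Types C s : R.

(** Each term of the geometric sum of [C^(n+1) - s^(n+1)] is at least [s^n]. The factor
    [4 s^2 + 2 = (C + s)^2 + (C - s)^2] compensates [(C - s)^2], because [(C - s) (C + s) = 1]. *)
Lemma pow_diff_ge C s n : 0 < s -> s < C -> C ^+ 2 = s ^+ 2 + 1 ->
  n.+1%:R ^+ 2 * (s ^+ 2) ^+ n <= (C ^+ n.+1 - s ^+ n.+1) ^+ 2 * (4 * s ^+ 2 + 2).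
Proof.
move=> s0 sC CE; have C0 : 0 < C by apply: lt_trans sC.
have geo : n.+1%:R * s ^+ n <= \sum_(i < n.+1) C ^+ (n - i) * s ^+ i.
  rewrite -{1}(card_ord n.+1) -sumr_const mulr_suml; apply: ler_sum => i _.
  rewrite mul1r -{1}(@subnK i n); last by rewrite -ltnS.
  rewrite exprD ler_wpM2r ?exprn_ge0 ?(ltW s0)//.
  by rewrite lerXn2r ?nnegrE ?(ltW s0) ?(ltW C0) ?(ltW sC).
rewrite subrXX /=.
set S := \sum_(i < _) _ in geo *.
have sn0 : 0 <= n.+1%:R * s ^+ n by apply: mulr_ge0 => //; apply: exprn_ge0; exact: ltW.
have -> : n.+1%:R ^+ 2 * (s ^+ 2) ^+ n = (n.+1%:R * s ^+ n) ^+ 2.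
  by rewrite [RHS]exprMn exprAC.
have sq : (n.+1%:R * s ^+ n) ^+ 2 <= S ^+ 2.
  by rewrite ler_pXn2r// nnegrE (le_trans sn0 geo).
apply: le_trans sq _.
have -> : ((C - s) * S) ^+ 2 * (4 * s ^+ 2 + 2) = S ^+ 2 * ((C - s) ^+ 2 * (4 * s ^+ 2 + 2)).
  by ring.
rewrite ler_peMr ?sqr_ge0//.
have E1 : (C - s) * (C + s) = 1 by rewrite -subr_sqr CE; ring.
have -> : (C - s) ^+ 2 * (4 * s ^+ 2 + 2) = ((C - s) * (C + s)) ^+ 2 + (C - s) ^+ 2 * (C - s) ^+ 2.
  have -> : 4 * s ^+ 2 + 2 = 2 * (C ^+ 2 + s ^+ 2) by rewrite CE; ring.
  by ring.
by rewrite E1 expr1n lerDl mulr_ge0 ?sqr_ge0.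
Qed.

(** [C^n - s^n >= (C - s) C^(n-1) >= C^(n-2) / 2], as [2 C (C - s) >= (C + s) (C - s) = 1]. The
    factor 2 in the threshold contributes [2^(n-2) >= 8], which beats the 4 lost by squaring. *)
Lemma power_ineq_large C s n : (4 < n)%N -> 0 < s -> s < C -> C ^+ 2 = s ^+ 2 + 1 ->
  2 * (n%:R - 1) <= C ^+ 2 -> (n%:R - 1) ^+ (n - 2) < (C ^+ n - s ^+ n) ^+ 2.
Proof.
move=> n4 s0 sC CE h; have C0 : 0 < C by apply: lt_trans sC.
have nR : 5 <= n%:R :> R by rewrite ler_nat.
have : 1 <= 2 * C * (C - s).
  have : (C - s) * (C + s) = 1 by rewrite -subr_sqr CE; ring.
  have : 0 <= (C - s) ^+ 2 by rewrite sqr_ge0.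
  nra.
case: n n4 h nR => [//|[//|[//|k]]] k2 h nR CCs.
have h1 : C ^+ k.+1 <= 2 * (C ^+ k.+3 - s ^+ k.+3).
  rewrite subrXX big_ord_recl /= mulr1 subn0.
  set S := \sum_(i < _) _.
  have S0 : 0 <= S.
    by apply: sumr_ge0 => i _; apply: mulr_ge0; apply: exprn_ge0; exact: ltW.
  have Cs0 : 0 <= (C - s) * S by rewrite mulr_ge0// subr_ge0 ltW.
  have Ck : 0 <= C ^+ k.+1 by rewrite exprn_ge0// ltW.
  have : C ^+ k.+1 * 1 <= C ^+ k.+1 * (2 * C * (C - s)) by rewrite ler_wpM2l.
  rewrite [C ^+ k.+2]exprSr; nra.
have Ck0 : 0 <= C ^+ k.+1 by rewrite exprn_ge0// ltW.
have h2 : (C ^+ k.+1) ^+ 2 <= (2 * (C ^+ k.+3 - s ^+ k.+3)) ^+ 2.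
  by rewrite ler_pXn2r// nnegrE (le_trans Ck0 h1).
rewrite subSS subSS subn0.
have h3 : (2 * (k.+3%:R - 1)) ^+ k.+1 <= (C ^+ 2) ^+ k.+1.
  by rewrite lerXn2r// nnegrE ?sqr_ge0//; lra.
rewrite exprMn in h3.
have p2 : 8 <= 2 ^+ k.+1 :> R.
  rewrite -natrX ler_nat -[8%N]/(2 ^ 3)%N leq_exp2l//.
have p0 : 0 < (k.+3%:R - 1) ^+ k.+1 :> R by rewrite exprn_gt0//; lra.
have : 8 * (k.+3%:R - 1) ^+ k.+1 <= 2 ^+ k.+1 * (k.+3%:R - 1) ^+ k.+1 :> R.
  by rewrite ler_wpM2r// ltW.
have : (C ^+ 2) ^+ k.+1 = (C ^+ k.+1) ^+ 2 by rewrite exprAC.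
move: h2 h3; rewrite (exprMn _ 2); lra.
Qed.

(** Since [5 / 16 < 1 / pi], the threshold [25 / 256 n^2] lies below the limit of [C^2]. From
    [n = 11] on it yields [s^2 >= n - 1]; smaller [n] are computed. *)
Lemma power_ineq_mid C s n : (6 < n)%N -> 0 < s -> s < C -> C ^+ 2 = s ^+ 2 + 1 ->
  25 / 256 * n%:R ^+ 2 <= C ^+ 2 -> (n%:R - 1) ^+ (n - 2) < (C ^+ n - s ^+ n) ^+ 2.
Proof.
move=> n6 s0 sC CE h.
have nR : 7 <= n%:R :> R by rewrite ler_nat.
have y0 : 0 < s ^+ 2 by rewrite exprn_gt0.
have H : n%:R ^+ 2 * (s ^+ 2) ^+ (n - 1) <= (C ^+ n - s ^+ n) ^+ 2 * (4 * s ^+ 2 + 2).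
  by case: n n6 h nR => // n n6 _ _; rewrite subn1 /=; apply: pow_diff_ge.
rewrite -(@ltr_pM2r _ (4 * s ^+ 2 + 2)); last lra.
apply: lt_le_trans H.
have -> : (n - 1 = (n - 2).+1)%N by lia.
rewrite CE in h; move: (s ^+ 2) y0 h => y y0 h; rewrite [y ^+ _.+1]exprSr.
(* What remains is [(4 y + 2) (n - 1)^(n-2) < n^2 y^(n-1)]; [q] is a lower bound of
   [(y / (n - 1))^(n-2)]. *)
suff [q qE H] : exists2 q : R, q * (n%:R - 1) ^+ (n - 2) <= y ^+ (n - 2) &
    4 * y + 2 < n%:R ^+ 2 * q * y.
  have p0 : 0 < (n%:R - 1) ^+ (n - 2) :> R by rewrite exprn_gt0//; lra.
  have h1 : (4 * y + 2) * (n%:R - 1) ^+ (n - 2) < n%:R ^+ 2 * q * y * (n%:R - 1) ^+ (n - 2).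
    by rewrite ltr_pM2r.
  have h2 : n%:R ^+ 2 * y * (q * (n%:R - 1) ^+ (n - 2)) <= n%:R ^+ 2 * y * y ^+ (n - 2).
    by rewrite ler_wpM2l// mulr_ge0 ?sqr_ge0// ltW.
  move: h1 h2; move: (_ ^+ (n - 2)) (y ^+ (n - 2)) => P Y; lra.
have [n10|n10] := leqP 11 n.
  have nR' : 11 <= n%:R :> R by rewrite ler_nat.
  have yn : n%:R - 1 <= y by nra.
  exists 1; first by rewrite mul1r lerXn2r// nnegrE; lra.
  have : 121 <= n%:R ^+ 2 :> R by nra.
  nra.
have pw (a b q : R) k : 0 <= a -> a <= y -> q * b ^+ k <= a ^+ k -> q * b ^+ k <= y ^+ k.
  move=> a0 ay qb; apply: le_trans qb _; by rewrite lerXn2r ?nnegrE// (le_trans a0).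
have : [|| n == 7, n == 8, n == 9 | n == 10]%N by move: n6 n10; lia.
(* The lower bounds of [y] are [25 / 256 n^2 - 1], rounded down; each [q] is then a rounded lower
   bound. *)
case/or4P => /eqP E; rewrite E in h *; rewrite !subSS subn0.
- exists (99 / 1000); last lra.
  apply: (pw (378 / 100)); lra.
- exists (1 / 6); last lra.
  apply: (pw (525 / 100)); lra.
- exists (1 / 3); last lra.
  apply: (pw (69 / 10)); lra.
- exists (1 / 2); last lra.
  apply: (pw (87 / 10)); lra.
Qed.

(** [26^2 = 676] exceeds [5^4 = 625], and [37 / 10] lies below the limit 4 of [C^2]. *)
Lemma power_ineq6 C s : 0 < s -> s < C -> C ^+ 2 = s ^+ 2 + 1 ->
  37 / 10 <= C ^+ 2 -> (6%:R - 1) ^+ (6 - 2) < (C ^+ 6 - s ^+ 6) ^+ 2.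
Proof.
move=> s0 sC CE; have -> : C ^+ 6 = (C ^+ 2) ^+ 3 by ring.
have -> : s ^+ 6 = (s ^+ 2) ^+ 3 by ring.
rewrite CE; move: (s ^+ 2) => y h.
have h1 : 26 <= (y + 1) ^+ 3 - y ^+ 3 by nra.
apply: (@lt_le_trans _ _ (26 ^+ 2)); first by rewrite /=; lra.
by rewrite ler_pXn2r// nnegrE; lra.
Qed.

(** The relation confines [p] between [q / 3] and [q / 2], so the right side is at least
    [(11 / 9)^2 q^4] and the left at most [128 q]; the cube of [133 / 30] is just above the 87 that
    suffices. *)
Lemma pentagon_aux (p q : R) : 0 < p -> 133 / 30 <= q -> q ^+ 2 - 4 * p ^+ 2 = 1 ->
  64 * (q + 2 * p) < (q ^+ 2 + p * q - p ^+ 2) ^+ 2.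
Proof.
move=> p0 q1 pq.
have q0 : 0 < q by apply: lt_le_trans q1.
have q2 : (133 / 30) ^+ 2 <= q ^+ 2 by rewrite lerXn2r ?nnegrE ?(ltW q0).
have q3 : 87 <= q ^+ 3.
  apply: (@le_trans _ _ ((133 / 30) ^+ 3)); first by lra.
  by rewrite lerXn2r ?nnegrE ?(ltW q0).
have p_le : p <= q / 2.
  by rewrite -(@ler_pXn2r _ 2)// ?nnegrE ?(ltW p0) ?divr_ge0 ?(ltW q0)//; lra.
have p_ge : 1 / 3 * q <= p.
  by rewrite -(@ler_pXn2r _ 2)// ?nnegrE ?(ltW p0) ?mulr_ge0 ?(ltW q0)//; lra.
have num : 11 / 9 * q ^+ 2 <= q ^+ 2 + p * q - p ^+ 2.
  have h1 : 0 <= p - 1 / 3 * q by lra.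
  have h2 : 0 <= q / 2 - p by lra.
  have := mulr_ge0 h1 h2; have := mulr_ge0 h1 (ltW q0); have := sqr_ge0 q; lra.
apply: (@lt_le_trans _ _ ((11 / 9 * q ^+ 2) ^+ 2)); last first.
  by rewrite lerXn2r ?nnegrE ?(le_trans _ num)// mulr_ge0 ?sqr_ge0.
have -> : (11 / 9 * q ^+ 2) ^+ 2 = (11 / 9) ^+ 2 * (q ^+ 3 * q) by ring.
have : 87 * q <= q ^+ 3 * q by rewrite ler_wpM2r// ltW.
lra.
Qed.

(** Multiplying by [(C + s)^2 = q + 2 p] removes the odd powers and leaves a polynomial in [p] and
    [q]. *)
Lemma power_ineq5 C s : 0 < s -> s < C -> C ^+ 2 = s ^+ 2 + 1 ->
  163 / 60 <= C ^+ 2 -> (5%:R - 1) ^+ (5 - 2) < (C ^+ 5 - s ^+ 5) ^+ 2.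
Proof.
move=> s0 sC CE h.
pose q := C ^+ 2 + s ^+ 2; pose p := C * s.
have p0 : 0 < p by apply: mulr_gt0 => //; apply: lt_trans sC.
have qE : q = 2 * s ^+ 2 + 1 by rewrite /q CE; ring.
have q1 : 133 / 30 <= q by lra.
have pq : q ^+ 2 - 4 * p ^+ 2 = 1.
  have -> : q ^+ 2 - 4 * p ^+ 2 = (C ^+ 2 - s ^+ 2) ^+ 2 by rewrite /q /p; ring.
  by rewrite CE addrAC subrr add0r expr1n.
have E : (C ^+ 5 - s ^+ 5) ^+ 2 * (q + 2 * p) = (q ^+ 2 + p * q - p ^+ 2) ^+ 2.
  have E1 : (C ^+ 2 - s ^+ 2) ^+ 2 = 1 by rewrite CE addrAC subrr add0r expr1n.
  have -> : (C ^+ 5 - s ^+ 5) ^+ 2 * (q + 2 * p) =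
    (C ^+ 2 - s ^+ 2) ^+ 2 * (q ^+ 2 + p * q - p ^+ 2) ^+ 2 by rewrite /q /p; ring.
  by rewrite E1 mul1r.
have -> : (5%:R - 1) ^+ (5 - 2) = 64 :> R by rewrite /=; ring.
rewrite -(@ltr_pM2r _ (q + 2 * p)); last by rewrite addr_gt0 ?mulr_gt0//; lra.
by rewrite E; exact: pentagon_aux.
Qed.

End PowerInequalities.

(** * Bounds for the inradius *)

Section PolygonEstimates.
Variables (R : realType) (n : nat).
Hypothesis n3 : (3 < n)%N.

Let sn : R := sin (pi / n%:R).

Lemma sin_pin_le : sn <= 16 / 5 / n%:R.
Proof.
have nR : 4 <= n%:R :> R by rewrite ler_nat.
have pg := pi_gt0 R; have pl := ltW (pi_lt_16_5 R).
apply: (@le_trans _ _ (pi / n%:R)); first by rewrite sin_le_id// divr_ge0//; lra.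
by rewrite ler_wpM2r// invr_ge0; lra.
Qed.

(** The bound [a^2 - a^4 / 4], obtained through the cosine, is sharper than the square of
    [sin x <= x]; it serves the pentagon and the hexagon. *)
Lemma sin_pin_sqr_le (a : R) : 16 / 5 / n%:R <= a -> a <= 1 -> sn ^+ 2 <= 1 - (1 - a ^+ 2 / 2) ^+ 2.
Proof.
move=> na a1; have nR : 4 <= n%:R :> R by rewrite ler_nat.
have pg := pi_gt0 R; have pl := ltW (pi_lt_16_5 R).
rewrite /sn sin2cos2 lerD2l lerN2.
have pa : pi / n%:R <= a.
  by apply: le_trans na; rewrite ler_wpM2r// invr_ge0; lra.
have p0 : 0 <= pi / n%:R :> R by rewrite divr_ge0//; lra.
have := cos_ge_deg2 (pi / n%:R : R); set c := cos _ => hc.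
have pa2 : (pi / n%:R) ^+ 2 <= a ^+ 2 by rewrite ler_pXn2r ?nnegrE// (le_trans p0).
have a2 : a ^+ 2 <= 1 by rewrite expr_le1// (le_trans p0).
by rewrite lerXn2r ?nnegrE; lra.
Qed.

Lemma polygon_cosh_sqr_ge (T : R) (m : nat) : (3 < m)%N ->
  T * sn ^+ 2 <= cos (pi / m%:R) ^+ 2 -> T <= polygon_cosh R n m ^+ 2.
Proof.
move=> m3 h; have sp := @sin_pin_gt0 R n n3.
by rewrite /polygon_cosh expr_div_n ler_pdivlMr// exprn_gt0.
Qed.

Lemma polygon_cosh_gt1 (T : R) (m : nat) : (3 < m)%N -> 1 < T ->
  T <= polygon_cosh R n m ^+ 2 -> 1 < polygon_cosh R n m.
Proof.
move=> m3 T1 h; have mR : 4 <= m%:R :> R by rewrite ler_nat.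
have pg := pi_gt0 R.
have C0 : 0 <= polygon_cosh R n m.
  apply: divr_ge0; last by apply/ltW/sin_pin_gt0.
  apply: cos_ge0_pihalf; apply/andP; split.
    by apply: (@le_trans _ _ 0); [lra|rewrite divr_ge0//; lra].
  by rewrite ler_pdivrMr; nra.
rewrite -(@ltr_pXn2r _ 2)// ?nnegrE// expr1n.
exact: lt_le_trans h.
Qed.

Lemma polygon_cosh_eventually (T : R) : 0 <= T -> T * sn ^+ 2 < 1 ->
  exists M : nat, forall m, (3 < m)%N -> (M <= m)%N -> T <= polygon_cosh R n m ^+ 2.
Proof.
move=> T0 h; pose e := 1 - T * sn ^+ 2; have e0 : 0 < e by rewrite subr_gt0.
(* 12 exceeds [(16 / 5)^2], hence [pi^2], so that [(pi / m)^2 <= e] for these [m]. *)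
exists (Num.truncn (12 / e)).+1 => m m3 hm; apply: polygon_cosh_sqr_ge => //.
have mR : 4 <= m%:R :> R by rewrite ler_nat.
have pg := pi_gt0 R; have pl := ltW (pi_lt_16_5 R).
have me : 12 / e <= m%:R.
  by apply/ltW/(lt_le_trans (truncnS_gt _)); rewrite ler_nat.
rewrite cos2sin2.
have s0 : 0 <= sin (pi / m%:R) :> R by apply/ltW/sin_pin_gt0.
have sm : sin (pi / m%:R) <= pi / m%:R :> R by rewrite sin_le_id// divr_ge0//; lra.
have s2 : sin (pi / m%:R) ^+ 2 <= (pi / m%:R) ^+ 2 :> R.
  by rewrite ler_pXn2r// nnegrE// (le_trans s0).
have : (pi / m%:R) ^+ 2 <= e.
  rewrite expr_div_n ler_pdivrMr ?exprn_gt0//; try lra.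
  rewrite ler_pdivrMr// in me.
  have : m%:R * e * 1 <= m%:R * e * m%:R.
    by rewrite ler_wpM2l ?mulr_ge0 ?(ltW e0)//; lra.
  nra.
rewrite /e; lra.
Qed.

End PolygonEstimates.

(** * The case of four sides *)

Section Square.
Variables (R : realType) (m : nat).
Hypotheses (m3 : (3 < m)%N) (m_even : ~~ odd m).
Local Notation C := (polygon_cosh R 4 m).
Local Notation s := (polygon_sinh R 4 m).
Hypothesis C1 : 1 < C.
Implicit Types (x y z : 'cV[R]_3) (i : 'I_4).

(** [a] and [b] are the hyperbolic cosine and sine of twice the inradius; [a] tends to 3 as [m]
    grows. *)
Let a : R := C ^+ 2 + s ^+ 2.
Let b : R := 2 * C * s.

Let ab : a ^+ 2 - b ^+ 2 = 1.
Proof.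
have -> : a ^+ 2 - b ^+ 2 = (C ^+ 2 - s ^+ 2) ^+ 2 by rewrite /a /b; ring.
by rewrite (polygon_sinhE C1) (_ : C ^+ 2 - _ = 1) ?expr1n//; ring.
Qed.

Let b0 : 0 < b.
Proof.
have C0 : 0 < C by apply: lt_trans C1.
by rewrite /b; apply: mulr_gt0 (polygon_sinh_gt0 C1); apply: mulr_gt0.
Qed.

Let a1 : 1 < a.
Proof.
have a0 : 0 <= a by rewrite addr_ge0 ?sqr_ge0.
rewrite -(@ltr_pXn2r _ 2)// ?nnegrE// expr1n.
have b2 : 0 < b ^+ 2 by rewrite exprn_gt0// b0.
by have := ab; lra.
Qed.

Let i0 : 'I_4 := @Ordinal 4 0 isT.
Let i1 : 'I_4 := @Ordinal 4 1 isT.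
Let i2 : 'I_4 := @Ordinal 4 2 isT.
Let i3 : 'I_4 := @Ordinal 4 3 isT.

Let sum4 (f : 'I_4 -> R) : \sum_i f i = f i0 + f i1 + f i2 + f i3.
Proof.
rewrite !big_ord_recl big_ord0 addr0 !addrA.
by do !congr (_ + _); congr f; apply: val_inj.
Qed.

Let angle i : side_angle R i = i%:R * (pi / 2).
Proof. by rewrite /side_angle; field. Qed.

Let cs0 : cos (side_angle R i0) = 1 /\ sin (side_angle R i0) = 0.
Proof. by rewrite angle mul0r cos0 sin0. Qed.

Let cs1 : cos (side_angle R i1) = 0 /\ sin (side_angle R i1) = 1.
Proof. by rewrite angle mul1r cos_pihalf sin_pihalf. Qed.

Let cs2 : cos (side_angle R i2) = -1 /\ sin (side_angle R i2) = 0.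
Proof.
have -> : side_angle R i2 = pi by rewrite angle /=; field.
by rewrite cospi sinpi.
Qed.

Let cs3 : cos (side_angle R i3) = 0 /\ sin (side_angle R i3) = -1.
Proof.
have -> : side_angle R i3 = pi / 2 + pi by rewrite angle /=; field.
by rewrite cosDpi sinDpi cos_pihalf sin_pihalf oppr0.
Qed.

Let height y :
  [/\ (gen 4 m i0 *m y) 0 0 = a * y 0 0 - b * y 1 0,
      (gen 4 m i1 *m y) 0 0 = a * y 0 0 - b * y 2%:R 0,
      (gen 4 m i2 *m y) 0 0 = a * y 0 0 + b * y 1 0 &
      (gen 4 m i3 *m y) 0 0 = a * y 0 0 + b * y 2%:R 0].
Proof.
case: cs0 cs1 cs2 cs3 => [c0 d0] [c1 d1] [c2 d2] [c3 d3].
by split; rewrite gen_height// ?c0 ?c1 ?c2 ?c3 ?d0 ?d1 ?d2 ?d3 /a /b; ring.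
Qed.

Let coord y :
  [/\ (gen 4 m i0 *m y) 1 0 = b * y 0 0 - a * y 1 0 /\
        (gen 4 m i0 *m y) 2%:R 0 = y 2%:R 0,
      (gen 4 m i1 *m y) 1 0 = y 1 0 /\
        (gen 4 m i1 *m y) 2%:R 0 = b * y 0 0 - a * y 2%:R 0,
      (gen 4 m i2 *m y) 1 0 = - (b * y 0 0) - a * y 1 0 /\
        (gen 4 m i2 *m y) 2%:R 0 = y 2%:R 0 &
      (gen 4 m i3 *m y) 1 0 = y 1 0 /\
        (gen 4 m i3 *m y) 2%:R 0 = - (b * y 0 0) - a * y 2%:R 0].
Proof.
case: cs0 cs1 cs2 cs3 => [c0 d0] [c1 d1] [c2 d2] [c3 d3].
have aE : a = 2 * C ^+ 2 - 1 by rewrite /a (polygon_sinhE C1); ring.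
by rewrite !gen_mulE !minkE !side_normalE aE /b c0 c1 c2 c3 d0 d1 d2 d3; split; split; ring.
Qed.

Let L y := \sum_i ln ((gen 4 m i *m y) 0 0).

(** Multiplying opposite sides first, the product of the four heights is [a^2 y0^4] plus two
    nonnegative terms, one relevant near the origin and one away from the axes. [e] is the relative
    gain over [one_step_bound]. *)
Let Lbound y (e : R) : inH2 y -> 0 <= e ->
  e * a ^+ 2 * y 0 0 ^+ 4 <= a ^+ 2 * b ^+ 2 * y 0 0 ^+ 2 + b ^+ 4 * y 1 0 ^+ 2 * y 2%:R 0 ^+ 2 ->
  4 * ln (y 0 0) + 2 * ln a + ln (1 + e) <= L y.
Proof.
move=> hy e0 he; have [y0 yE] := inH2P hy; have [h0 h1 h2 h3] := height y.
have a0 : 0 < a by apply: lt_trans a1.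
rewrite /L sum_ln; last by move=> i; have [] := inH2P (gen_H2 C1 i hy).
have -> : \prod_i (gen 4 m i *m y) 0 0 =
    a ^+ 2 * y 0 0 ^+ 4 + a ^+ 2 * b ^+ 2 * y 0 0 ^+ 2 + b ^+ 4 * y 1 0 ^+ 2 * y 2%:R 0 ^+ 2.
  rewrite !big_ord_recl big_ord0 mulr1.
  have -> : ord0 = i0 by apply: val_inj.
  have -> : lift i0 ord0 = i1 by apply: val_inj.
  have -> : lift i0 (lift ord0 ord0) = i2 by apply: val_inj.
  have -> : lift i0 (lift ord0 (lift ord0 ord0)) = i3 by apply: val_inj.
  rewrite h0 h1 h2 h3.
  have bE : b ^+ 2 = a ^+ 2 - 1 by rewrite -ab; ring.
  transitivity ((a ^+ 2 * y 0 0 ^+ 2 - b ^+ 2 * y 1 0 ^+ 2) *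
    (a ^+ 2 * y 0 0 ^+ 2 - b ^+ 2 * y 2%:R 0 ^+ 2)); first by ring.
  have -> : b ^+ 4 = b ^+ 2 * b ^+ 2 by ring.
  have -> : y 0 0 ^+ 4 = y 0 0 ^+ 2 * y 0 0 ^+ 2 by ring.
  by rewrite bE yE; ring.
have -> : 4 * ln (y 0 0) + 2 * ln a + ln (1 + e) = ln (y 0 0 ^+ 4 * a ^+ 2 * (1 + e)).
  have p1 : 0 < y 0 0 ^+ 4 by rewrite exprn_gt0.
  have p2 : 0 < a ^+ 2 by rewrite exprn_gt0.
  have p3 : 0 < 1 + e by lra.
  have p4 := mulr_gt0 p1 p2.
  rewrite (@lnM _ (y 0 0 ^+ 4 * a ^+ 2) (1 + e)) ?posrE//.
  by rewrite (@lnM _ (y 0 0 ^+ 4) (a ^+ 2)) ?posrE// !lnXn// !mulr_natl.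
have p0 : 0 < y 0 0 ^+ 4 * a ^+ 2 * (1 + e).
  apply: mulr_gt0; last lra.
  by apply: mulr_gt0; apply: exprn_gt0.
have hle : y 0 0 ^+ 4 * a ^+ 2 * (1 + e) <= a ^+ 2 * y 0 0 ^+ 4 +
  a ^+ 2 * b ^+ 2 * y 0 0 ^+ 2 + b ^+ 4 * y 1 0 ^+ 2 * y 2%:R 0 ^+ 2 by lra.
by rewrite ler_ln ?posrE// (lt_le_trans p0).
Qed.

Hypotheses (a_ge : 3 - 1 / 750 <= a) (a_le : a <= 3).

Let b_ge : 74 / 10 <= b ^+ 2.
Proof.
have a29 : 29 / 10 <= a by apply: le_trans a_ge; lra.
have : (29 / 10) ^+ 2 <= a ^+ 2 by rewrite lerXn2r ?nnegrE// ?(le_trans _ a29)//; lra.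
by have := ab; lra.
Qed.

(** The condition of [Lbound] with [e = 1 / 100] at a reflected point: its height is [a y0 + b u]
    and its spatial coordinates are, up to sign and order, [a u + b y0] and [w]. *)
Let transverse (y0 u w : R) : 0 < y0 -> 0 <= u -> u <= y0 -> 3 / 8 * y0 ^+ 2 <= w ^+ 2 ->
  1 / 100 * a ^+ 2 * (a * y0 + b * u) ^+ 4 <= b ^+ 4 * (a * u + b * y0) ^+ 2 * w ^+ 2.
Proof.
move=> y0p u0 uy hw.
have b2 := b_ge.
have a2 : a ^+ 2 <= 9.
  have -> : 9 = 3 ^+ 2 :> R by ring.
  by rewrite lerXn2r ?nnegrE//; apply: ltW; apply: lt_trans a1.
have b3 : b <= 3 by rewrite -(@ler_pXn2r _ 2)// ?nnegrE ?(ltW b0)//; have := ab; lra.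
have z0 : 0 <= a * y0 + b * u.
  by rewrite addr_ge0// mulr_ge0// ltW//; apply: lt_trans a1.
have z6 : a * y0 + b * u <= 6 * y0.
  have : a * y0 <= 3 * y0 by rewrite ler_wpM2r// ltW.
  have : b * u <= 3 * y0 by apply: ler_pM => //; exact: ltW.
  lra.
have z4 : (a * y0 + b * u) ^+ 4 <= 1296 * y0 ^+ 4.
  have -> : 1296 * y0 ^+ 4 = (6 * y0) ^+ 4 by ring.
  by rewrite lerXn2r ?nnegrE// mulr_ge0// ltW.
have z1 : b ^+ 2 * y0 ^+ 2 <= (a * u + b * y0) ^+ 2.
  rewrite -exprMn; have by0 : 0 <= b * y0 by rewrite mulr_ge0 ?ltW.
  have au : 0 <= a * u by rewrite mulr_ge0// ltW//; apply: lt_trans a1.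
  by rewrite lerXn2r ?nnegrE//; lra.
have y4 : 0 <= y0 ^+ 4 by rewrite exprn_ge0// ltW.
have lhs : 1 / 100 * a ^+ 2 * (a * y0 + b * u) ^+ 4 <= 1 / 100 * 9 * (1296 * y0 ^+ 4).
  by apply: ler_pM => //; [rewrite mulr_ge0 ?sqr_ge0|exact: exprn_ge0|lra].
apply: le_trans lhs _.
have b40 : 0 <= b ^+ 4 by rewrite exprn_ge0// ltW.
have r1 : b ^+ 4 * (b ^+ 2 * y0 ^+ 2) * (3 / 8 * y0 ^+ 2) <=
    b ^+ 4 * (a * u + b * y0) ^+ 2 * w ^+ 2.
  apply: ler_pM => //.
  - exact: mulr_ge0 b40 (mulr_ge0 (sqr_ge0 _) (sqr_ge0 _)).
  - by apply: mulr_ge0; [lra|exact: sqr_ge0].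
  - by rewrite ler_wpM2l.
apply: le_trans r1.
have -> : b ^+ 4 * (b ^+ 2 * y0 ^+ 2) * (3 / 8 * y0 ^+ 2) = 3 / 8 * (b ^+ 2) ^+ 3 * y0 ^+ 4 by ring.
have : (74 / 10) ^+ 3 <= (b ^+ 2) ^+ 3 by rewrite lerXn2r ?nnegrE ?sqr_ge0//; lra.
move=> b6; rewrite mulrA ler_wpM2r//; lra.
Qed.

(* One step from a boundary point facing the midpoint of a side only yields the rate
   [ln a / 2], which tends to [ln 3 / 2], the entropy of the free product; but such a point
   is moved by some generator to a direction where the next step gains a definite amount. *)
Let two_step y : inH2 y ->
  16 * (ln (y 0 0) + ln a) + ln (1 + 1 / 100) <= \sum_i L (gen 4 m i *m y).
Proof.
move=> hy; have [y0 yE] := inH2P hy.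
have hg i := gen_H2 C1 i hy.
have b4 : 0 <= b ^+ 4 by apply: exprn_ge0; exact: ltW.
have quart z : 0 <= b ^+ 4 * z 1 0 ^+ 2 * z 2%:R 0 ^+ 2.
  exact: mulr_ge0 (mulr_ge0 b4 (sqr_ge0 _)) (sqr_ge0 _).
have rest z : 0 <= a ^+ 2 * b ^+ 2 * z 0 0 ^+ 2 + b ^+ 4 * z 1 0 ^+ 2 * z 2%:R 0 ^+ 2.
  by apply: addr_ge0 => //; exact: mulr_ge0 (mulr_ge0 (sqr_ge0 _) (sqr_ge0 _)) (sqr_ge0 _).
have base i : 4 * ln ((gen 4 m i *m y) 0 0) + 2 * ln a <= L (gen 4 m i *m y).
  have := @Lbound _ 0 (hg i) (lexx 0); rewrite addr0 ln1 addr0; apply.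
  by rewrite !mul0r rest.
have base0 : 4 * ln (y 0 0) + 2 * ln a <= L y.
  have := @Lbound _ 0 hy (lexx 0); rewrite addr0 ln1 addr0; apply.
  by rewrite !mul0r rest.
have gain : 0 <= ln (1 + 1 / 100) :> R by rewrite ln_ge0//; lra.
have b2 := b_ge.
(* Up to height 2 the first step from [y] already gains, through the term [a^2 b^2 y0^2]; beyond it,
   one generator with a gain at the second step suffices. *)
have [y2|y2] := leP (y 0 0) 2.
  have g0 : 4 * ln (y 0 0) + 2 * ln a + ln (1 + 1 / 100) <= L y.
    apply: Lbound => //.
    have : 1 / 100 * y 0 0 ^+ 2 <= b ^+ 2 by nra.
    have : 0 <= a ^+ 2 * y 0 0 ^+ 2 by rewrite mulr_ge0 ?sqr_ge0.
    have := quart y.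
    have -> : 1 / 100 * a ^+ 2 * y 0 0 ^+ 4 = (a ^+ 2 * y 0 0 ^+ 2) * (1 / 100 * y 0 0 ^+ 2) by ring.
    move=> p1 p2 p3.
    have : (a ^+ 2 * y 0 0 ^+ 2) * (1 / 100 * y 0 0 ^+ 2) <= (a ^+ 2 * y 0 0 ^+ 2) * b ^+ 2.
      by rewrite ler_wpM2l.
    lra.
  have : \sum_i (4 * ln ((gen 4 m i *m y) 0 0) + 2 * ln a) <= \sum_i L (gen 4 m i *m y).
    by apply: ler_sum => i _; exact: base.
  rewrite big_split /= -mulr_sumr -/(L y) sumr_const card_ord -mulr_natl; lra.
suff [i hi] : exists i, 4 * ln ((gen 4 m i *m y) 0 0) + 2 * ln a + ln (1 + 1 / 100)
    <= L (gen 4 m i *m y).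
  have : \sum_j (4 * ln ((gen 4 m j *m y) 0 0) + 2 * ln a) + ln (1 + 1 / 100)
      <= \sum_j L (gen 4 m j *m y).
    rewrite (bigD1 i)//= [leRHS](bigD1 i)//= addrAC lerD//.
    by apply: ler_sum => j _; exact: base.
  rewrite big_split /= -mulr_sumr -/(L y) sumr_const card_ord -mulr_natl; lra.
have [h0 h1 h2 h3] := height y; have [[k00 k01] [k10 k11] [k20 k21] [k30 k31]] := coord y.
have a0 : 0 < a by apply: lt_trans a1.
have [le1 le2] := inH2_norm_le hy.
have choose i u w (ci : (gen 4 m i *m y) 0 0 = a * y 0 0 + b * u) :
    0 <= u -> u <= y 0 0 -> 3 / 8 * y 0 0 ^+ 2 <= w ^+ 2 ->
    (gen 4 m i *m y) 1 0 ^+ 2 * (gen 4 m i *m y) 2%:R 0 ^+ 2 = (a * u + b * y 0 0) ^+ 2 * w ^+ 2 ->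
    4 * ln ((gen 4 m i *m y) 0 0) + 2 * ln a + ln (1 + 1 / 100) <= L (gen 4 m i *m y).
  move=> u0 uy hw E; apply: Lbound => //.
  rewrite -[b ^+ 4 * _ * _]mulrA E ci mulrA.
  apply: le_trans (transverse y0 u0 uy hw) _; rewrite lerDr.
  exact: mulr_ge0 (mulr_ge0 (sqr_ge0 _) (sqr_ge0 _)) (sqr_ge0 _).
have y04 : 2 ^+ 2 <= y 0 0 ^+ 2 by rewrite lerXn2r ?nnegrE// ltW.
(* Above height 2 the two squared coordinates sum to at least [3 / 4 y0^2], so one of them is at
   least [3 / 8 y0^2]. The chosen generator fixes that coordinate and moves the other so as to raise
   the height. *)
have [hw|hw] := leP (3 / 8 * y 0 0 ^+ 2) (y 2%:R 0 ^+ 2).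
  have [s1|s1] := leP (y 1 0) 0.
    exists i0; apply: (@choose i0 (- y 1 0) (y 2%:R 0)) => //.
    - by rewrite h0; ring.
    - lra.
    - by move: le1; rewrite ler0_norm.
    - by rewrite k00 k01; ring.
  exists i2; apply: (@choose i2 (y 1 0) (y 2%:R 0)) => //.
  - exact: ltW.
  - by move: le1; rewrite gtr0_norm.
  - by rewrite k20 k21; ring.
have {}hw : 3 / 8 * y 0 0 ^+ 2 <= y 1 0 ^+ 2 by lra.
have [s1|s1] := leP (y 2%:R 0) 0.
  exists i1; apply: (@choose i1 (- y 2%:R 0) (y 1 0)) => //.
  - by rewrite h1; ring.
  - lra.
  - by move: le2; rewrite ler0_norm.
  - by rewrite k10 k11; ring.
exists i3; apply: (@choose i3 (y 2%:R 0) (y 1 0)) => //.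
- exact: ltW.
- by move: le2; rewrite gtr0_norm.
- by rewrite k30 k31; ring.
Qed.

(** [V] adds to the log-height its mean after one step, so the mean gain of [V] is that of the
    log-height over two steps; accordingly [t = 2]. *)
Lemma square_inequality x0 : inH2 x0 -> strict_fundamental_inequality 4 m x0.
Proof.
move=> hx; have a0 : 0 < a by apply: lt_trans a1.
refine (@drift_criterion R 4 m isT m3 m_even C1 x0 (fun y => ln (y 0 0) + 4^-1 * L y) 2
  (ln (a + b)) (ln a + ln (1 + 1 / 100) / 16) hx _ _ _ _) => //.
- move=> y hy; have [y0 yE] := inH2P hy.
  suff : L y <= 4 * (ln (a + b) + ln (y 0 0)) by lra.
  have [h0 h1 h2 h3] := height y.
  have [le1 le2] := inH2_norm_le hy.
  have le i u : `|u| <= y 0 0 -> (gen 4 m i *m y) 0 0 = a * y 0 0 + b * u ->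
      ln ((gen 4 m i *m y) 0 0) <= ln (a + b) + ln (y 0 0).
    move=> /(le_trans (ler_norm _)) uy E; have g0 := (inH2P (gen_H2 C1 i hy)).1.
    have abp : 0 < a + b by rewrite addr_gt0.
    rewrite -lnM ?posrE// ler_ln ?posrE// ?(mulr_gt0 abp)// E.
    have h : b * u <= b * y 0 0 by rewrite ler_wpM2l// ltW.
    by rewrite [leRHS]mulrDl; apply: lerD.
  rewrite /L sum4 -!mulrN in h0 h1 *.
  have -> (X : R) : 4 * X = X + X + X + X by ring.
  apply: lerD; last exact: le le2 h3.
  apply: lerD; last exact: le le1 h2.
  by apply: lerD; [apply: le h0|apply: le h1]; rewrite normrN.
- move=> y hy; have := two_step hy.
  rewrite big_split /= -mulr_sumr -/(L y); lra.
have -> : 2 * ((4%:R - 2) / 4%:R * ln (4%:R - 1)) = ln 3 :> R.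
  by have -> : 4%:R - 1 = 3 :> R by [lra]; lra.
suff : ln (3 ^+ 16) < ln (a ^+ 16 * (1 + 1 / 100)) :> R.
  rewrite (@lnM _ (a ^+ 16) (1 + 1 / 100)) ?posrE; [|exact: exprn_gt0|lra].
  rewrite !lnXn//; lra.
have ap : 0 < a ^+ 16 * (1 + 1 / 100) by apply: mulr_gt0; [exact: exprn_gt0|lra].
rewrite ltr_ln ?posrE ?exprn_gt0//.
have dbl (k t : R) : k <= 1 -> 1 - k <= t -> 1 - 2 * k <= t ^+ 2.
  move=> k1 kt; have : (1 - k) ^+ 2 <= t ^+ 2.
    by rewrite lerXn2r ?nnegrE ?(le_trans _ kt) ?subr_ge0.
  by have := sqr_ge0 k; lra.
(* Four squarings turn [a / 3 >= 1 - 1 / 2250] into a loss of at most [16 / 2250], which the factor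
   [1 + 1 / 100] outweighs. *)
have t16 : 1 - 2 * (2 * (2 * (2 * (1 / 2250)))) <= (a / 3) ^+ 2 ^+ 2 ^+ 2 ^+ 2.
  have t1 : 1 - 1 / 2250 <= a / 3 by move: a_ge; lra.
  by do 4![apply: (dbl _ _); first by lra].
have -> : a ^+ 16 = 3 ^+ 16 * (a / 3) ^+ 2 ^+ 2 ^+ 2 ^+ 2.
  by rewrite -!exprM -exprMn mulrC divfK.
rewrite -mulrA ltr_pMr ?exprn_gt0//; lra.
Qed.

End Square.

(** * The exceptional pairs *)

Section Exceptions.
Variable R : realType.

Lemma strict_if_power_criterion (n m : nat) (T : R) : (3 < n)%N -> (3 < m)%N -> ~~ odd m ->
  1 < T -> T <= polygon_cosh R n m ^+ 2 ->
  (forall C s : R, 0 < s -> s < C -> C ^+ 2 = s ^+ 2 + 1 -> T <= C ^+ 2 ->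
    (n%:R - 1) ^+ (n - 2) < (C ^+ n - s ^+ n) ^+ 2) ->
  forall x0 : 'cV[R]_3, inH2 x0 -> strict_fundamental_inequality n m x0.
Proof.
move=> n3 m3 me T1 TC H x0 hx; have C1 := polygon_cosh_gt1 n3 m3 T1 TC.
apply: power_criterion => //; apply: H => //.
- exact: polygon_sinh_gt0.
- exact: cosh_gt_sinh.
- by rewrite (polygon_sinhE C1) subrK.
Qed.

(** For every [m], [cos (pi / m)^2 >= 1 / 2] and [sin (pi / n) <= 16 / (5 n)] give
    [C^2 >= 25 n^2 / 512], which reaches [2 (n - 1)] from [n = 40] on. *)
Lemma strict_large (n m : nat) : (39 < n)%N -> (3 < m)%N -> ~~ odd m ->
  forall x0 : 'cV[R]_3, inH2 x0 -> strict_fundamental_inequality n m x0.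
Proof.
move=> n39 m3 me.
have n3 : (3 < n)%N by lia.
have nR : 40 <= n%:R :> R by rewrite ler_nat.
apply: (@strict_if_power_criterion n m (2 * (n%:R - 1))) => //; first lra.
  apply: polygon_cosh_sqr_ge => //.
  have c2 := @cos_sqr_ge_half R m m3; apply: le_trans c2.
  have sl := @sin_pin_le R n n3; have s0 := ltW (@sin_pin_gt0 R n n3).
  have s2 : sin (pi / n%:R) ^+ 2 <= (16 / 5 / n%:R) ^+ 2 :> R.
    by rewrite ler_pXn2r// nnegrE// (le_trans s0).
  have n0 : 0 < n%:R :> R by lra.
  apply: (@le_trans _ _ (2 * (n%:R - 1) * (16 / 5 / n%:R) ^+ 2)).
    by rewrite ler_wpM2l//; lra.
  rewrite expr_div_n mulrA ler_pdivrMr ?exprn_gt0//; nra.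
move=> C s s0 sC CE TC; apply: power_ineq_large => //; lia.
Qed.

Lemma strict_eventually (n : nat) : (3 < n)%N ->
  exists M : nat, forall m, (3 < m)%N -> ~~ odd m -> (M <= m)%N ->
  forall x0 : 'cV[R]_3, inH2 x0 -> strict_fundamental_inequality n m x0.
Proof.
move=> n3; have nR : 4 <= n%:R :> R by rewrite ler_nat.
have sp := @sin_pin_gt0 R n n3; have sl := @sin_pin_le R n n3.
have conclude (T : R) : 1 < T -> T * sin (pi / n%:R) ^+ 2 < 1 ->
    (forall C s : R, 0 < s -> s < C -> C ^+ 2 = s ^+ 2 + 1 -> T <= C ^+ 2 ->
    (n%:R - 1) ^+ (n - 2) < (C ^+ n - s ^+ n) ^+ 2) ->
    exists M : nat, forall m, (3 < m)%N -> ~~ odd m -> (M <= m)%N ->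
    forall x0 : 'cV[R]_3, inH2 x0 -> strict_fundamental_inequality n m x0.
  move=> T1 Ts H; have T0 : 0 <= T by lra.
  have [M HM] := polygon_cosh_eventually n3 T0 Ts.
  exists M => m m3 me hm; apply: (strict_if_power_criterion n3 m3 me T1 (HM m m3 hm)).
  exact: H.
have [n7|n7] := leqP 7 n.
  have nR7 : 7 <= n%:R :> R by rewrite ler_nat.
  apply: (conclude (25 / 256 * n%:R ^+ 2)); first by nra.
    have pg := pi_gt0 R; have pl := pi_lt_16_5 R.
    have s1 : sin (pi / n%:R) < 16 / 5 / n%:R :> R.
      apply: (@le_lt_trans _ _ (pi / n%:R)); first by rewrite sin_le_id// divr_ge0//; lra.
      by rewrite ltr_pM2r// invr_gt0; lra.
    have s2 : sin (pi / n%:R) ^+ 2 < (16 / 5 / n%:R) ^+ 2 :> R.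
      by rewrite ltr_pXn2r// nnegrE ?(ltW sp)// (le_trans (ltW sp))// ltW.
    have n2 : 0 < 25 / 256 * n%:R ^+ 2 :> R by nra.
    have E1 : 25 / 256 * n%:R ^+ 2 * (16 / 5 / n%:R) ^+ 2 = 1 :> R by field; lra.
    by rewrite -[ltRHS]E1 ltr_pM2l.
  by move=> C s s0 sC CE TC; apply: power_ineq_mid.
have : [|| n == 4, n == 5 | n == 6]%N by move: n3 n7; lia.
case/or3P => /eqP E; move: nR sp sl conclude n3 {n7}; rewrite E => nR sp sl conclude n3.
- have s2 : sin (pi / 4%:R) ^+ 2 = 1 / 2 :> R.
    have : cos ((pi / 4%:R) *+ 2) = 0 :> R.
      by rewrite -mulr_natr (_ : pi / 4%:R * 2%:R = pi / 2) ?cos_pihalf//; field.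
    by rewrite cos_mulr2n cos2sin2 -mulr_natr; lra.
  (* Since [a = 2 C^2 - 1], this threshold and [C^2 <= 2] place [a] between [3 - 1 / 750] and 3. *)
  have T0 : 0 <= 2 - 1 / 1500 :> R by lra.
  have Ts : (2 - 1 / 1500) * sin (pi / 4%:R) ^+ 2 < 1 :> R by rewrite s2; lra.
  have [M HM] := polygon_cosh_eventually n3 T0 Ts.
  exists M => m m3 me hm x0 hx; have TC := HM m m3 hm.
  have T1 : 1 < 2 - 1 / 1500 :> R by lra.
  have C1 := polygon_cosh_gt1 n3 m3 T1 TC.
  have sE := polygon_sinhE C1.
  have C2 : polygon_cosh R 4 m ^+ 2 <= 2.
    rewrite /polygon_cosh expr_div_n s2 ler_pdivrMr; last lra.
    by rewrite cos2sin2; have := sqr_ge0 (sin (pi / m%:R : R)); lra.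
  by apply: square_inequality => //; rewrite sE; lra.
- have h : sin (pi / 5%:R) ^+ 2 <= 1 - (1 - (16 / 25) ^+ 2 / 2) ^+ 2 :> R.
    by apply: sin_pin_sqr_le => //; lra.
  apply: (conclude (163 / 60)); [lra|lra|].
  by move=> C s s0 sC CE TC; apply: power_ineq5.
- have h : sin (pi / 6%:R) ^+ 2 <= 1 - (1 - (8 / 15) ^+ 2 / 2) ^+ 2 :> R.
    by apply: sin_pin_sqr_le => //; lra.
  apply: (conclude (37 / 10)); [lra|lra|].
  by move=> C s s0 sC CE TC; apply: power_ineq6.
Qed.

End Exceptions.

Unset Implicit Arguments.

Theorem theorem1 (R : realType) :
  exists S : seq (nat * nat),
    forall n m : nat, (3 < n)%N -> (3 < m)%N -> ~~ odd m -> (n, m) \notin S ->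
    forall x0 : 'cV[R]_3, inH2 x0 -> trivial_stabilizer n m x0 ->
    exists h l v : R,
      (fun k : nat => @entropy_k R n m k / k%:R) @ \oo --> h /\
      (fun k : nat => drift_k n m x0 k / k%:R) @ \oo --> l /\
      (fun k : nat => ln ((ball_card n m x0 k)%:R : R) / k%:R) @ \oo --> v /\
      h < l * v.
Proof.
have /choice[M HM] : forall n : nat, exists M : nat, (3 < n)%N ->
    forall m, (3 < m)%N -> ~~ odd m -> (M <= m)%N ->
    forall x0 : 'cV[R]_3, inH2 x0 -> strict_fundamental_inequality n m x0.
  move=> n; have [n3|n3] := boolP (3 < n)%N; last by exists 0%N.
  by have [M HM] := strict_eventually R n3; exists M.
(* One box covers all pairs below their threshold, since no [m] is excluded once [n >= 40]. *)
exists [seq (n, m) | n <- iota 0 40, m <- iota 0 (\max_(n < 40) M n)].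
move=> n m n3 m3 me nm x0 hx _.
have [n40|n40] := leqP 40 n; first exact: (strict_large n40 m3 me hx).
apply: (HM n n3 m m3 me _ x0 hx); rewrite leqNgt; apply: contra nm => mM.
apply/allpairsP; exists (n, m); rewrite !mem_iota /= !add0n; split => //.
by apply: leq_trans mM _; rewrite -[n]/(nat_of_ord (Ordinal n40)); apply: leq_bigmax.
Qed.
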